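(* Let $(\delta_k)_{k\ge1}$ be a non-increasing sequence with $0\le\delta_k<1$ and $\sum_k\delta_k=\infty$, let $(\xi_k)_{k\ge1}$ be independent $\{0,1\}$-valued random variables with $\mathbb E(\xi_k)=\delta_k$, and let $R=\{k\in\mathbb N:\xi_k=1\}$. Put $m_N=\sum_{k=1}^N\delta_k$. If $m_N=O(\log N)$ as $N\to\infty$, then $R$ is almost surely a Sidon set, and hence almost surely not Hartman-distributed.
   Context: $\mathbb N=\{1,2,\ldots\}$, $\mathbb T=\mathbb R/\mathbb Z$. A set $E\subset\mathbb Z$ is a Sidon set if every $f\in L^\infty(\mathbb T)$ with $\widehat f(n)=0$ for all $n\notin E$ satisfies $\sum_n|\widehat f(n)|<\infty$. An infinite set $E=\{n_1<n_2<\cdots\}\subset\mathbb N$ is Hartman-distributed if $\frac1N\sum_{k=1}^N e^{2i\pi n_kx}\to0$ as $N\to\infty$ for every $x\in\mathbb T$, $x\ne0$. *)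

(* Defs.v *)
From HB Require Import structures.
From mathcomp Require Import all_boot all_order all_algebra finmap.
From mathcomp Require Import all_classical all_reals all_analysis.
From mathcomp Require Import ess_sup_inf complex.

Set Implicit Arguments.
Unset Strict Implicit.
Unset Printing Implicit Defensive.

Import Order.TTheory GRing.Theory Num.Theory.
Import numFieldNormedType.Exports.
Import Normc.

Local Open Scope classical_set_scope.
Local Open Scope complex_scope.
Local Open Scope ring_scope.

(* e^(2 i pi t) *)
Definition cis2pi {R : realType} (t : R) : R[i] :=
  cos (2 * pi * t) +i* sin (2 * pi * t).

Definition Cintegral {d} {T : measurableType d} {R : realType}
    (mu : {measure set T -> \bar R}) (D : set T) (f : T -> R[i]) : R[i] :=
  (\int[mu]_(x in D) complex.Re (f x)) +i* (\int[mu]_(x in D) complex.Im (f x)).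

(* Functions on R / Z are 1-periodic functions on R.  Almost everywhere classes
   are not quotiented: each class has Borel representatives, and the Fourier
   coefficients below do not depend on the representative. *)
Definition Linfty_circle {R : realType} (f : R -> R[i]) : Prop :=
  [/\ periodic f 1,
      measurable_fun [set: R] (fun x => complex.Re (f x)),
      measurable_fun [set: R] (fun x => complex.Im (f x)) &
      (ess_sup lebesgue_measure (fun x : R => (normc (f x))%:E) < +oo)%E].

Definition fourier_coef {R : realType} (f : R -> R[i]) (n : int) : R[i] :=
  Cintegral lebesgue_measure `[0, 1]%classic
    (fun x : R => f x * cis2pi (- (n%:~R * x))).

Definition sidon (R : realType) (E : set int) : Prop :=
  forall f : R -> R[i], Linfty_circle f ->
    (forall n, ~ E n -> fourier_coef f n = 0) ->
    summable [set: int] (fun n => (normc (fourier_coef f n))%:E).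

(* The set is infinite and n_1 < n_2 < ... is its increasing enumeration,
   indexed from 0; x in R represents a nonzero class of R / Z. *)
Definition hartman_distributed (R : realType) (E : set nat) : Prop :=
  exists2 n : nat -> nat, increasing_seq n /\ range n = E &
    forall x : R, x \isn't a Num.int ->
      normc (N%:R^-1 * \sum_(k < N) cis2pi ((n k)%:R * x)) @[N --> \oo]
        --> (0 : R).

(* Mutual independence of the family (X i), i in D: product rule over every
   finite subfamily. *)
Definition independent_RVs {d} {T : measurableType d} {R : realType}
    (P : probability T R) (I : choiceType) (D : set I) (X : I -> {RV P >-> R})
    : Prop :=
  forall (J : {fset I}) (B : I -> set R), [set` J] `<=` D ->
    (forall i, i \in J -> measurable (B i)) ->
    P (\bigcap_(i in [set` J]) (X i @^-1` B i)) =
      (\prod_(i <- J) P (X i @^-1` B i))%E.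
Arguments independent_RVs {d T R} P {I} D X.

Definition random_set {d} {T : measurableType d} {R : realType}
    (P : probability T R) (xi : nat -> {RV P >-> R}) (w : T) : set nat :=
  [set k | (0 < k)%N /\ xi k w = 1].

(* Main.v *)
(** For [b] supported on the random set, let [riesz b N m] be the [m]-th Fourier
    coefficient of a Riesz product over the frequencies [k] and [2 k], [k <= N].
    With small coefficients [a * xi k], the expected zeroth coefficient stays bounded
    in [N]: in a vanishing combination of frequencies the largest one is determined
    by the others and is at most as likely as the second largest, which leaves a
    factor [delta k ^ 2 * exp (4 a m_k)], summable since [m_N = O(log N)].  Monotone
    convergence makes the zeroth coefficient almost surely bounded, say by [B], and by
    positivity this bounds every coefficient of every Riesz product with smaller
    coefficients; scaling by [l] makes the terms of degree at least 2 [O(l ^ 2)].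

    Sidon: testing the Fejer means of [f] against the Riesz product whose signs are
    those of the Fourier coefficients bounds the sum of their absolute values.

    Not Hartman-distributed: under the probability with density proportional to
    [prod (1 - t cos (2 pi k x))], the averages of [cos (2 pi n_j x)] are close to
    [- t / 2] with exponentially small failure probability, because the exponential
    moment is again the zeroth coefficient of a Riesz product with coefficients at
    [k] and [2 k].  By compactness one [x] works for all large averages, and [x] is
    not an integer since there the averages equal 1. *)

Require Import Defs.
From HB Require Import structures.
From mathcomp Require Import all_boot all_order all_algebra finmap.
From mathcomp Require Import all_classical all_reals all_analysis.
From mathcomp Require Import measurable_realfun ess_sup_inf complex.
From mathcomp Require Import zify ring lra.

Set Implicit Arguments.
Unset Strict Implicit.
Unset Printing Implicit Defensive.

Import Order.TTheory GRing.Theory Num.Theory.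
Import numFieldNormedType.Exports.
Import Normc.

Local Open Scope classical_set_scope.
Local Open Scope ring_scope.

(** * Coefficients of Riesz products *)

(** The multiples [2] and [-2] make room for the square of [cos (2 pi k x)], which appears when a
    Riesz product is multiplied by a second factor at the same frequency. *)
Definition shifts : seq int := [:: 1; -1; 2; -2].

(** Coefficient of [z ^ m] in the product over [1 <= k <= N] of [1 + \sum_i b k i * z ^ (i * k)].
    Working on coefficients alone turns domination and expectation into finite algebra. *)
Fixpoint riesz {R : realType} (b : nat -> int -> R) (N : nat) (m : int) : R :=
  if N is n.+1 then
    riesz b n m + \sum_(i <- shifts) b N i * riesz b n (m - i * N%:Z)
  else (m == 0)%:R.

Section riesz_coefficients.
Variable R : realType.
Implicit Types (b c : nat -> int -> R) (N : nat) (m : int).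

Lemma rieszS b N m : riesz b N.+1 m =
  riesz b N m + \sum_(i <- shifts) b N.+1 i * riesz b N (m - i * N.+1%:Z).
Proof. by []. Qed.

Lemma riesz_ge0 b N m : (forall k i, 0 <= b k i) -> 0 <= riesz b N m.
Proof.
move=> b0; elim: N m => [|N IH] m; first by rewrite /= ler0n.
by rewrite rieszS addr_ge0// sumr_ge0// => i _; rewrite mulr_ge0.
Qed.

Lemma riesz_nd b m : (forall k i, 0 <= b k i) ->
  {homo (riesz b)^~ m : N N' / (N <= N')%N >-> N <= N'}.
Proof.
move=> b0; apply: homo_leq => [//|y x z|N]; first exact: le_trans.
by rewrite rieszS lerDl sumr_ge0// => i _; rewrite mulr_ge0// riesz_ge0.
Qed.

Lemma riesz_dominated b c N m :
  (forall k i, (0 < k <= N)%N -> `|b k i| <= c k i) ->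
  `|riesz b N m| <= riesz c N m.
Proof.
elim: N m => [|N IH] m bc; first by rewrite /= ger0_norm.
have {}IH m' : `|riesz b N m'| <= riesz c N m'.
  by apply: IH => k i /andP[k0 kN]; apply: bc; rewrite k0 leqW.
rewrite !rieszS (le_trans (ler_normD _ _))// lerD//.
rewrite (le_trans (ler_norm_sum _ _ _))//; apply: ler_sum => i _.
by rewrite normrM ler_pM// bc /=.
Qed.

(** The sum of all coefficients is the value of the product at [z = 1], and distinct exponents
    collect only a part of it. Translation by [i * N.+1] keeps exponents distinct. *)
Lemma riesz_sum_le b N (s : seq int) : (forall k i, 0 <= b k i) -> uniq s ->
  \sum_(m <- s) riesz b N m <= \prod_(1 <= k < N.+1) (1 + \sum_(i <- shifts) b k i).
Proof.
move=> b0; elim: N s => [|N IH] s us.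
  have [s0|s0] := boolP (0 \in s).
    by rewrite (bigD1_seq 0)//= big1 ?addr0 ?big_geq// => i /negPf ->.
  rewrite big_geq// big_seq big1// => i si /=; have [i0|//] := eqVneq i 0.
  by rewrite i0 (negPf s0) in si.
rewrite big_nat_recr//= big_split /= mulrDr mulr1 lerD ?IH//.
rewrite exchange_big /= mulr_sumr; apply: ler_sum => i _.
rewrite -mulr_sumr mulrC ler_wpM2r//.
rewrite -(big_map (fun m => m - i * N.+1%:Z) xpredT (riesz b N)) IH//.
by rewrite map_inj_uniq// => x y /addIr.
Qed.

(** Terms are grouped by the largest [k] whose factor contributes something other than 1; what
    remains involves smaller frequencies only. *)
Lemma riesz_expand b N m : riesz b N m = (m == 0)%:R +
  \sum_(1 <= k < N.+1) \sum_(i <- shifts) b k i * riesz b k.-1 (m - i * k%:Z).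
Proof.
elim: N => [|N IH]; first by rewrite big_geq// addr0.
by rewrite rieszS IH [in RHS]big_nat_recr//= addrA.
Qed.

Definition riesz_lin b N m : R :=
  \sum_(1 <= k < N.+1) \sum_(i <- shifts) b k i * (m == i * k%:Z)%:R.

(** Every monomial except the constant 1 has one factor bounded by [l * c]; its other factors are
    bounded by [c]. *)
Lemma riesz_remainder0 b c (l : R) N m : 0 <= l -> (forall k i, 0 <= c k i) ->
  (forall k i, (0 < k <= N)%N -> `|b k i| <= l * c k i) ->
  (forall k i, (0 < k <= N)%N -> `|b k i| <= c k i) ->
  `|riesz b N m - (m == 0)%:R| <= l * riesz c N m.
Proof.
move=> l0 c0; elim: N m => [|N IH] m blc bc.
  by rewrite /= subrr normr0 mulr_ge0.
have sub k : (0 < k <= N)%N -> (0 < k <= N.+1)%N.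
  by move=> /andP[-> /leqW ->].
rewrite !rieszS addrAC mulrDr (le_trans (ler_normD _ _))// lerD//.
  by apply: IH => k i /sub; [exact: blc|exact: bc].
rewrite mulr_sumr (le_trans (ler_norm_sum _ _ _))//; apply: ler_sum => i _.
rewrite normrM mulrA ler_pM// ?blc//=.
by apply: riesz_dominated => k j /sub; exact: bc.
Qed.

(** Without the constant and the part [riesz_lin] of degree one in [b], every monomial has two
    factors bounded by [l * c]; for the others [l <= 1] gives the bound [c]. *)
Lemma riesz_remainder b c (l : R) N m : 0 <= l -> l <= 1 ->
  (forall k i, 0 <= c k i) ->
  (forall k i, (0 < k <= N)%N -> `|b k i| <= l * c k i) ->
  `|riesz b N m - (m == 0)%:R - riesz_lin b N m| <= l ^+ 2 * riesz c N m.
Proof.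
move=> l0 l1 c0; elim: N m => [|N IH] m blc.
  by rewrite /riesz_lin big_geq//= subrr subr0 normr0 mulr_ge0// exprn_ge0.
have sub k : (0 < k <= N)%N -> (0 < k <= N.+1)%N.
  by move=> /andP[-> /leqW ->].
have -> : riesz b N.+1 m - (m == 0)%:R - riesz_lin b N.+1 m =
    (riesz b N m - (m == 0)%:R - riesz_lin b N m) +
    \sum_(i <- shifts) b N.+1 i *
      (riesz b N (m - i * N.+1%:Z) - (m - i * N.+1%:Z == 0)%:R).
  rewrite /riesz_lin big_nat_recr//= -/(riesz_lin b N m).
  have -> : \sum_(i <- shifts) b N.+1 i *
      (riesz b N (m - i * N.+1%:Z) - (m - i * N.+1%:Z == 0)%:R) =
    \sum_(i <- shifts) b N.+1 i * riesz b N (m - i * N.+1%:Z) -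
    \sum_(i <- shifts) b N.+1 i * (m == i * N.+1%:Z)%:R.
    by rewrite -sumrB; apply: eq_bigr => i _; rewrite mulrBr subr_eq0.
  by ring.
rewrite rieszS mulrDr (le_trans (ler_normD _ _))// lerD//.
  by apply: IH => k i /sub; exact: blc.
rewrite mulr_sumr (le_trans (ler_norm_sum _ _ _))//; apply: ler_sum => i _.
rewrite normrM expr2 mulrACA ler_pM// ?blc//=.
apply: riesz_remainder0 => // k j /sub; first exact: blc.
by move=> /blc /le_trans; apply; rewrite ler_piMl.
Qed.

End riesz_coefficients.

(** * Riesz products and averages over the points [k / Q] *)

Definition cosm {R : realType} (m : int) (x : R) : R := cos (2 * pi * (m%:~R * x)).

(** Stands in for the integral over the circle, with which it agrees on cosine polynomials of degree
    below [Q]. *)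
Definition avg {R : realType} (Q : nat) (f : R -> R) : R :=
  Q%:R^-1 * \sum_(k < Q) f (k%:R / Q%:R).

Definition rieszP {R : realType} (b : nat -> int -> R) (N : nat) (x : R) : R :=
  \prod_(1 <= k < N.+1) (1 + \sum_(i <- shifts) b k i * cosm (i * k%:Z) x).

Section riesz_products.
Variable R : realType.
Implicit Types (b c : nat -> int -> R) (N : nat) (m : int).

Lemma cosmN m (x : R) : cosm (- m) x = cosm m x.
Proof. by rewrite /cosm rmorphN mulNr mulrN cosN. Qed.

Lemma cosm0 (x : R) : cosm 0 x = 1.
Proof. by rewrite /cosm mul0r mulr0 cos0. Qed.

Lemma cosmM m n (x : R) : cosm m x * cosm n x = (cosm (m - n) x + cosm (m + n) x) / 2.
Proof.
rewrite /cosm; set a := 2 * pi * (m%:~R * x); set b := 2 * pi * (n%:~R * x).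
have -> : 2 * pi * ((m - n)%:~R * x) = a - b by rewrite /a /b rmorphB/=; ring.
have -> : 2 * pi * ((m + n)%:~R * x) = a + b by rewrite /a /b rmorphD/=; ring.
by rewrite cosB cosD; field.
Qed.

Lemma cosm_le1 m (x : R) : `|cosm m x| <= 1.
Proof. exact: cos_max. Qed.

Lemma continuous_cosm m : continuous (@cosm R m).
Proof.
move=> x; rewrite (_ : cosm m = cos \o (fun y : R => 2 * pi * (m%:~R * y)))//.
apply: continuous_comp; last exact: continuous_cos.
by apply: cvgM; [exact: cvg_cst|apply: cvgM; [exact: cvg_cst|exact: cvg_id]].
Qed.

Lemma cosD2pin (y : R) n : cos (y + 2 * pi * n%:R) = cos y.
Proof.
by rewrite mulr_natr [2 * pi]mulr_natl periodicn//; exact: cosD2pi.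
Qed.

Lemma sinD2pin (y : R) n : sin (y + 2 * pi * n%:R) = sin y.
Proof.
by rewrite mulr_natr [2 * pi]mulr_natl periodicn//; exact: sinD2pi.
Qed.

Lemma cosm_int m (x : R) : x \is a Num.int -> cosm m x = 1.
Proof.
move=> /intrP[z ->]; rewrite /cosm -intrM.
case: (intP (m * z)) => [|n|n].
- by rewrite mulr0z mulr0 cos0.
- by rewrite -pmulrn -[2 * pi * _]add0r cosD2pin cos0.
- by rewrite rmorphN/= mulrN cosN -pmulrn -[2 * pi * _]add0r cosD2pin cos0.
Qed.

Lemma avgD Q (f g : R -> R) : avg Q (fun x => f x + g x) = avg Q f + avg Q g.
Proof. by rewrite /avg big_split mulrDr. Qed.

Lemma avgZ Q a (f : R -> R) : avg Q (fun x => a * f x) = a * avg Q f.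
Proof. by rewrite /avg -mulr_sumr mulrCA. Qed.

Lemma avg_sum Q I (s : seq I) (p : pred I) (f : I -> R -> R) :
  avg Q (fun x => \sum_(i <- s | p i) f i x) = \sum_(i <- s | p i) avg Q (f i).
Proof. by rewrite /avg exchange_big mulr_sumr. Qed.

Lemma ler_avg Q (f g : R -> R) : (forall x, f x <= g x) -> avg Q f <= avg Q g.
Proof. by move=> fg; rewrite ler_wpM2l ?invr_ge0// ler_sum. Qed.

Lemma eq_avg Q (f g : R -> R) : f =1 g -> avg Q f = avg Q g.
Proof. by move=> /funext ->. Qed.

Lemma avg_cosm Q m : (`|m| < Q)%N -> avg Q (@cosm R m) = (m == 0)%:R.
Proof.
move=> mQ; have Q0 : Q%:R != 0 :> R by rewrite pnatr_eq0; lia.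
have [->|m0] := eqVneq m 0.
  rewrite /avg (eq_bigr (fun=> 1)); last by move=> i _; rewrite cosm0.
  by rewrite sumr_const card_ord mulVf.
wlog [n mE] : m mQ m0 / exists n : nat, m = n.+1%:Z.
  move=> H; case: (intP m) mQ m0 => [|n|n] mQ m0; first by rewrite eqxx in m0.
    by apply: H => //; exists n.
  rewrite -(funext (cosmN _)); apply: H; rewrite ?abszN ?oppr_eq0//.
  by exists n; rewrite opprK.
rewrite {m}mE in mQ m0 *.
(* Half the angle between consecutive sample points; it lies strictly between 0 and pi. Multiplying
   by [2 * sin t] makes the sum of cosines telescope, and over [Q] terms the phase advances by a
   multiple of [2 * pi]. *)
pose t : R := pi * n.+1%:R / Q%:R.
have st : sin t != 0.
  apply/lt0r_neq0/sin_gt0_pi; rewrite /t; apply/andP; split.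
    by rewrite !mulr_gt0 ?pi_gt0// invr_gt0 ltr0n; lia.
  rewrite -mulrA gtr_pMr ?pi_gt0// ltr_pdivrMr ?mul1r ?ltr_nat//.
  by rewrite ltr0n; lia.
have tele K : 2 * sin t * \sum_(k < K) cosm n.+1%:Z (k%:R / Q%:R) =
    sin (2 * pi * n.+1%:R * K%:R / Q%:R - t) + sin t.
  elim: K => [|K IH]; first by rewrite big_ord0 !mulr0 mul0r sub0r sinN addNr.
  rewrite big_ord_recr/= mulrDr IH /cosm.
  have -> : 2 * pi * (n.+1%:~R * (K%:R / Q%:R)) = 2 * pi * n.+1%:R * K%:R / Q%:R :> R.
    by rewrite !mulrA.
  set z := 2 * pi * _ * K%:R / _.
  have -> : 2 * pi * n.+1%:R * K.+1%:R / Q%:R - t = z + t.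
    by rewrite /z /t -[K.+1]addn1 natrD; field.
  by rewrite sinB sinD; ring.
have : 2 * sin t * \sum_(k < Q) cosm n.+1%:Z (k%:R / Q%:R) = 0.
  by rewrite tele mulfK// [_ - t]addrC sinD2pin sinN addNr.
by move=> /eqP; rewrite /avg !mulf_eq0 pnatr_eq0/= (negPf st)/= => /eqP ->; rewrite mulr0.
Qed.

Definition shift_sym b := forall k i, b k (- i) = b k i.

(** Identifies [riesz] with the Fourier coefficients of the actual product. Factor [k] has degree at
    most [2 * k], so the product has degree at most [N * N.+1], whence the bound on [Q]. *)
Lemma avg_rieszP b N Q j : shift_sym b -> (`|j| + N * N.+1 < Q)%N ->
  avg Q (fun x => rieszP b N x * cosm j x) = riesz b N j.
Proof.
move=> bs; elim: N j => [|N IH] j jQ.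
  rewrite /= -(@avg_cosm Q); last by rewrite addn0 in jQ.
  by apply: eq_avg => x; rewrite /rieszP big_geq// mul1r.
rewrite rieszS -IH; last by lia.
have -> : \sum_(i <- shifts) b N.+1 i * riesz b N (j - i * N.+1%:Z) =
   avg Q (fun x => \sum_(i <- shifts) b N.+1 i *
     (rieszP b N x * cosm (j - i * N.+1%:Z) x)).
  rewrite avg_sum; apply: eq_big_seq => i; rewrite !inE => ish.
  rewrite avgZ IH//.
  have : (absz (j - i * N.+1%:Z)%R <= `|j| + 2 * N.+1)%N.
    by case/or4P : ish => /eqP ->; lia.
  move=> h; apply: leq_ltn_trans jQ.
  by rewrite mulnSr; lia.
rewrite -avgD; apply: eq_avg => x.
rewrite /rieszP big_nat_recr//= -/(rieszP b N x).
rewrite /shifts !big_cons big_nil !bs !mulN1r !mulNr !mul1r !opprK !cosmN.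
rewrite big_nil !addr0.
have := cosmM j N.+1%:Z x; have := cosmM j (2 * N.+1%:Z) x.
set p := rieszP b N x; set c0 := cosm j x.
set c1 := cosm (2 * _) x; set c2 := cosm N.+1%:Z x => e2 e1.
have -> : p * (1 + (b N.+1 1 * c2 + (b N.+1 1 * c2 +
    (b N.+1 2 * c1 + b N.+1 2 * c1)))) * c0 =
  p * c0 + 2 * (b N.+1 1 * p) * (c0 * c2) + 2 * (b N.+1 2 * p) * (c0 * c1).
  by ring.
by rewrite e1 e2; field.
Qed.

Lemma rieszP_ge0 b N x : (forall k, (0 < k <= N)%N -> \sum_(i <- shifts) `|b k i| <= 1) ->
  0 <= rieszP b N x.
Proof.
move=> b1; rewrite /rieszP big_nat; apply: prodr_ge0 => k /b1 {}b1.
rewrite -lerBlDl sub0r lerNl (le_trans _ b1)// (le_trans (ler_norm _))// normrN.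
rewrite (le_trans (ler_norm_sum _ _ _))//; apply: ler_sum => i _.
by rewrite normrM ler_piMr// cosm_le1.
Qed.

(** The product is non-negative under the second hypothesis, and a cosine coefficient of a
    non-negative function is at most its mean. *)
Lemma riesz_le0 b N m : shift_sym b ->
  (forall k, (0 < k <= N)%N -> \sum_(i <- shifts) `|b k i| <= 1) ->
  riesz b N m <= riesz b N 0.
Proof.
move=> bs b1; pose Q := (`|m| + N * N.+1).+1.
rewrite -(@avg_rieszP b N Q m)// -(@avg_rieszP b N Q 0)//; last first.
  by rewrite /Q absz0 ltnS leq_add2r.
apply: ler_avg => x; rewrite cosm0 ler_wpM2l ?rieszP_ge0//.
exact: le_trans (ler_norm _) (cosm_le1 _ _).
Qed.

End riesz_products.

(** * The mean of the zeroth coefficient *)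

Section mean_riesz_bound.
Variable R : realType.
Implicit Types (delta : nat -> R) (N k : nat).

(* The largest frequency of a vanishing combination is determined by the others,
   and its probability is at most that of the second largest. *)
Lemma riesz_noninc_le delta (a : R) N : 0 <= a ->
  (forall k l, (0 < k)%N -> (k <= l)%N -> delta l <= delta k) ->
  (forall k, 0 <= delta k) ->
  riesz (fun k _ => a * delta k) N 0 <= 1 + 16 * a ^+ 2 *
    \sum_(1 <= k < N.+1) delta k ^+ 2 * \prod_(1 <= l < k) (1 + 4 * a * delta l).
Proof.
move=> a0 dni d0; set c := fun k (_ : int) => a * delta k.
have c0 k i : 0 <= c k i by rewrite mulr_ge0.
rewrite riesz_expand eqxx lerD2l.
(* [n] is the largest frequency, with multiplier [j], and [k] the second largest, with multiplier
   [i]; [F] collects the ways in which smaller frequencies cancel them. *)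
pose F k n (j i : int) := riesz c k.-1 (0 - j * n%:Z - i * k%:Z).
have step n : (0 < n < N.+1)%N -> \sum_(j <- shifts) c n j * riesz c n.-1 (0 - j * n%:Z) <=
    \sum_(1 <= k < N.+1) a ^+ 2 * delta k ^+ 2 * \sum_(j <- shifts) \sum_(i <- shifts)
      (if (k < n)%N then F k n j i else 0).
  move=> /andP[n0 nN].
  under [leRHS]eq_bigr do rewrite mulr_sumr.
  rewrite exchange_big/= !big_seq; apply: ler_sum => j jsh.
  rewrite riesz_expand.
  (* The largest frequency alone does not vanish, so there is a second largest one. *)
  have -> : (0 - j * n%:Z == 0) = false.
    by move: jsh; rewrite !inE => /or4P[] /eqP ->; lia.
  rewrite add0r prednK// mulr_sumr.
  rewrite (big_nat_widen _ n N.+1); last by rewrite ltnW.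
  rewrite big_mkcond/= !big_nat; apply: ler_sum => k /andP[k0 kN].
  case: ifPn => [kn|nk]; last by rewrite mulr_ge0 ?mulr_ge0 ?sqr_ge0// sumr_ge0.
  rewrite -mulr_sumr mulrA ler_wpM2r//; first by apply: sumr_ge0 => i _; exact: riesz_ge0.
  (* Monotonicity with [k < n] replaces [delta n * delta k] by [delta k ^ 2]. *)
  rewrite /c mulrACA -expr2 ler_wpM2l ?sqr_ge0// expr2 ler_wpM2r//.
  by apply: dni => //; exact: ltnW.
apply: (@le_trans _ _ (\sum_(1 <= n < N.+1) \sum_(1 <= k < N.+1) a ^+ 2 * delta k ^+ 2 *
    \sum_(j <- shifts) \sum_(i <- shifts) (if (k < n)%N then F k n j i else 0))).
  by rewrite !big_nat; apply: ler_sum => n; exact: step.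
rewrite exchange_big/= mulr_sumr !big_nat; apply: ler_sum => k /andP[k0 kN].
rewrite -mulr_sumr.
have -> : 16 * a ^+ 2 * (delta k ^+ 2 * \prod_(1 <= l < k) (1 + 4 * a * delta l)) =
  a ^+ 2 * delta k ^+ 2 * (16 * \prod_(1 <= l < k) (1 + 4 * a * delta l)) by ring.
rewrite ler_wpM2l ?mulr_ge0 ?sqr_ge0//.
set p := \prod_(1 <= l < k) _.
(* For fixed [k], [j], [i], distinct [n] leave distinct exponents to be cancelled, so the sum over
   all [n] is at most the value at [z = 1] of the product over [l < k]. *)
have Fp (j i : int) : j != 0 ->
    \sum_(1 <= n < N.+1) (if (k < n)%N then F k n j i else 0) <= p.
  move=> j0.
  apply: (@le_trans _ _ (\sum_(1 <= n < N.+1) F k n j i)).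
    by apply: ler_sum => n _; case: ifPn => // _; exact: riesz_ge0.
  rewrite /F -(big_map (fun n : nat => 0 - j * n%:Z - i * k%:Z) xpredT (riesz c k.-1)).
  have -> : p = \prod_(1 <= l < k.-1.+1) (1 + \sum_(i <- shifts) c l i).
    rewrite prednK//; apply: eq_bigr => l _.
    by rewrite /shifts !big_cons big_nil /c; ring.
  apply: riesz_sum_le => //; rewrite map_inj_uniq ?iota_uniq//.
  by move=> x y /addIr /addrI /oppr_inj /(mulfI j0) [].
rewrite exchange_big/=.
under eq_bigr do rewrite exchange_big/=.
(* Four multipliers for each of the two largest frequencies. *)
have -> : 16 * p = \sum_(j <- shifts) \sum_(i <- shifts) p.
  by rewrite /shifts !big_cons !big_nil; ring.
rewrite [leLHS]big_seq [leRHS]big_seq; apply: ler_sum => j jsh.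
apply: ler_sum => i _; apply: Fp.
by move: jsh; rewrite !inE => /or4P[] /eqP ->.
Qed.

(** The term of index [N.+1] is at most [64 * C ^ 2 * N.+1 ^ (- 3 / 2)]. The sum is controlled by
    showing that, from [N0] on, the partial sum plus [128 * C ^ 2 / sqrt N] does not increase. *)
Lemma sum_noninc_prod_bounded delta (C : R) N0 : 0 < C -> (0 < N0)%N ->
  (forall k l, (0 < k)%N -> (k <= l)%N -> delta l <= delta k) ->
  (forall k, 0 <= delta k) ->
  (forall N, (N0 <= N)%N -> \sum_(1 <= k < N.+1) delta k <= C * ln N%:R) ->
  exists B, forall N, \sum_(1 <= k < N.+1) delta k ^+ 2 *
    \prod_(1 <= l < k) (1 + (4 * C)^-1 * delta l) <= B.
Proof.
move=> C0 N00 dni d0 mC.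
pose m N := \sum_(1 <= k < N.+1) delta k.
pose S N := \sum_(1 <= k < N.+1) delta k ^+ 2 *
    \prod_(1 <= l < k) (1 + (4 * C)^-1 * delta l).
have Snd : {homo S : N N' / (N <= N')%N >-> N <= N'}.
  apply: homo_leq => [//|y x z|N]; first exact: le_trans.
  rewrite /S [leRHS]big_nat_recr//= lerDl mulr_ge0 ?sqr_ge0//.
  by apply: prodr_ge0 => l _; rewrite addr_ge0// mulr_ge0// invr_ge0 mulr_ge0// ltW.
have step N : (N0 <= N)%N -> S N.+1 + 128 * C ^+ 2 / Num.sqrt N.+1%:R <=
    S N + 128 * C ^+ 2 / Num.sqrt N%:R.
  move=> N0N; rewrite {1}/S big_nat_recr//= -/(S N) -addrA lerD2l.
  have N_gt0 : (0 < N)%N by exact: leq_trans N0N.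
  (* The logarithmic bound gives [v ^ 8 <= N.+1]. The product is at most [v ^ 2], and
     [N.+1 * delta N.+1 <= m N.+1 <= 8 * C * v], so the new term carries [v ^ 4 <= sqrt N.+1]
     against [N.+1 ^ 2]. *)
  pose v := expR (m N.+1 / (8 * C)).
  have m_le : m N.+1 <= C * ln N.+1%:R by apply: mC; rewrite leqW.
  have v8 : v ^+ 8 <= N.+1%:R.
    rewrite /v -expRM_natl -ler_ln ?posrE ?expR_gt0// expRK.
    rewrite [X in X <= _](_ : _ = m N.+1 / C).
      by rewrite ler_pdivrMr// mulrC.
    by field; rewrite gt_eqF.
  have v0 : 0 < v by exact: expR_gt0.
  have dv : N.+1%:R * delta N.+1 <= 8 * C * v.
    apply: (@le_trans _ _ (m N.+1)).
      have -> : N.+1%:R * delta N.+1 = \sum_(1 <= k < N.+2) delta N.+1.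
        by rewrite sumr_const_nat subn1 mulr_natl.
      rewrite /m !big_nat; apply: ler_sum => k /andP[k0 kN].
      by apply: dni.
    rewrite mulrC -ler_pdivrMr ?mulr_gt0//.
    by apply: le_trans (expR_ge1Dx _); rewrite lerDr.
  have pv : \prod_(1 <= l < N.+1) (1 + (4 * C)^-1 * delta l) <= v ^+ 2.
    apply: (@le_trans _ _ (\prod_(1 <= l < N.+1) expR ((4 * C)^-1 * delta l))).
      apply: ler_prod => l _; rewrite expR_ge1Dx andbT addr_ge0// mulr_ge0//.
      by rewrite invr_ge0 mulr_ge0// ltW.
    rewrite -expR_sum -mulr_sumr /v -expRM_natl ler_expR.
    rewrite [leRHS](_ : _ = (4 * C)^-1 * m N.+1); last by field; rewrite gt_eqF.
    rewrite ler_wpM2l//; first by rewrite invr_ge0 mulr_ge0// ltW.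
    by rewrite /m [leRHS]big_nat_recr//= lerDl.
  set r := Num.sqrt N.+1%:R; set s := Num.sqrt N%:R.
  have r2 : r ^+ 2 = N.+1%:R by rewrite sqr_sqrtr.
  have s2 : s ^+ 2 = N%:R by rewrite sqr_sqrtr.
  have s0 : 0 < s by rewrite sqrtr_gt0 ltr0n.
  have r0 : 0 < r by rewrite sqrtr_gt0 ltr0n.
  have rs : r ^+ 2 = s ^+ 2 + 1 by rewrite r2 s2 -natr1.
  have v4 : v ^+ 4 <= r.
    rewrite -(@ler_pXn2r _ 2)// ?nnegrE; [|exact/exprn_ge0/ltW|exact: ltW].
    by rewrite -exprM r2.
  rewrite -lerBrDr -mulrBr.
  have dv2 : delta N.+1 ^+ 2 <= (8 * C * v / r ^+ 2) ^+ 2.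
    have w0 : 0 <= 8 * C * v / r ^+ 2.
      by apply: divr_ge0; [rewrite mulr_ge0 ?(ltW v0)// mulr_ge0// ltW|exact: sqr_ge0].
    rewrite ler_pXn2r// ?nnegrE//.
    by rewrite ler_pdivlMr ?exprn_gt0// mulrC r2.
  apply: (@le_trans _ _ ((8 * C * v / r ^+ 2) ^+ 2 * v ^+ 2)).
    apply: ler_pM => //; first exact: sqr_ge0.
    by apply: prodr_ge0 => l _; rewrite addr_ge0// mulr_ge0// invr_ge0 mulr_ge0// ltW.
  rewrite [leLHS](_ : _ = 128 * C ^+ 2 * (v ^+ 4 / (2 * r ^+ 4))); last first.
    by field; rewrite gt_eqF.
  apply: ler_wpM2l; first by rewrite mulr_ge0 ?sqr_ge0.
  apply: (@le_trans _ _ (r / (2 * r ^+ 4))).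
    by rewrite ler_wpM2r// invr_ge0 mulr_ge0// exprn_ge0// ltW.
  (* Since [r ^ 2 - s ^ 2 = 1] and [s <= r], this difference is at least [1 / (2 * r ^ 3)]. *)
  have -> : s^-1 - r^-1 = 1 / (s * r * (r + s)).
    have rs0 : r + s != 0 by rewrite gt_eqF// addr_gt0.
    have -> : 1 = (r - s) * (r + s) by rewrite -subr_sqr rs; ring.
    by field; rewrite rs0 !gt_eqF.
  have -> : r / (2 * r ^+ 4) = 1 / (2 * r ^+ 3) by field; rewrite gt_eqF.
  rewrite ler_pM2l// lef_pV2 ?posrE ?mulr_gt0 ?exprn_gt0 ?addr_gt0//.
  have sr : s <= r by rewrite ler_sqrt// ler_nat.
  rewrite [leLHS](_ : _ = r * (s * (r + s))); last by ring.
  rewrite [leRHS](_ : _ = r * (r * (r + r))); last by ring.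
  by rewrite ler_pM2l// ler_pM ?lerD// ?addr_ge0 ?ltW.
exists (S N0 + 128 * C ^+ 2 / Num.sqrt N0%:R) => N.
have pos k : 0 <= 128 * C ^+ 2 / Num.sqrt k%:R.
  by apply: divr_ge0; [rewrite mulr_ge0 ?sqr_ge0|exact: sqrtr_ge0].
have [NN0|/ltnW N0N] := leqP N N0.
  by rewrite -[leLHS]addr0 lerD ?Snd.
rewrite -[leLHS]addr0 (le_trans (lerD (lexx _) (pos N)))//.
elim: N N0N => [|N IH]; first by rewrite leqn0 => /eqP ->.
rewrite leq_eqVlt => /orP[/eqP -> //|]; rewrite ltnS => N0N.
exact: le_trans (step _ N0N) (IH N0N).
Qed.

End mean_riesz_bound.

(** * Riesz products over the random set *)

Section random_riesz.
Context {d : measure_display} {T : measurableType d} {R : realType}.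
Variables (P : probability T R) (delta : nat -> R) (xi : nat -> {RV P >-> R}).
Hypothesis xi_01 : forall k, (0 < k)%N -> forall w, xi k w = 0 \/ xi k w = 1.
Hypothesis xi_mean : forall k, (0 < k)%N -> 'E_P[xi k]%E = (delta k)%:E.
Hypothesis xi_indep : independent_RVs P [set k | (0 < k)%N] xi.

(** A product of [{0,1}]-valued variables is the indicator of an intersection of events, to which
    independence applies. *)
Lemma expectation_prod (s : seq nat) : uniq s -> (forall k, k \in s -> (0 < k)%N) ->
  (\int[P]_w (\prod_(k <- s) xi k w)%:E = (\prod_(k <- s) delta k)%:E)%E.
Proof.
move=> us s0; pose J := seq_fset tt s.
have Js : perm_eq J s by rewrite -[X in perm_eq _ X](undup_id us) seq_fset_perm.
have JE : [set` J] = [set` s] by apply/seteqP; split => k /=; rewrite (perm_mem Js).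
have mA k : measurable (xi k @^-1` [set 1]).
  by rewrite -[_ @^-1` _]setTI; apply: measurable_funP.
have indicE k w : (0 < k)%N -> xi k w = \1_(xi k @^-1` [set 1]) w.
  move=> k0; rewrite indicE.
  have [x0|x1] := xi_01 k0 w; last by rewrite mem_set.
  rewrite memNset// => /=; rewrite x0 => /eqP.
  by rewrite eq_sym oner_eq0.
have -> : (fun w => (\prod_(k <- s) xi k w)%:E) =
    (fun w => (\1_(\bigcap_(k in [set` J]) (xi k @^-1` [set 1])) w)%:E).
  apply/funext => w; congr (_%:E); rewrite JE.
  rewrite big_seq (eq_bigr (fun k => \1_(xi k @^-1` [set 1]) w)); last first.
    by move=> k ks; rewrite indicE// s0.
  rewrite -big_seq bigcap_seq.
  elim: (s) => [|k t IH]; first by rewrite !big_nil indicT.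
  by rewrite !big_cons indicI IH.
rewrite integral_indic//; last first.
  by rewrite JE bigcap_seq; apply: bigsetI_measurable.
have Jpos : [set` J] `<=` [set k | (0 < k)%N] by rewrite JE => k /= /s0.
have /= Pcap := @xi_indep J (fun=> [set 1]) Jpos (fun i _ => measurable_set1 1).
rewrite setIT Pcap.
rewrite (perm_big _ Js)/= -prodEFin; apply: eq_big_seq => k /s0 k0.
rewrite -xi_mean// expectation_def -[X in P X]setIT -integral_indic//.
by apply: eq_integral => w _; rewrite indicE.
Qed.

(** The value is set to 0 at index 0, where the hypotheses say nothing about [xi]. *)
Definition random_coef (a : R) (w : T) (k : nat) (_ : int) : R :=
  a * (if (0 < k)%N then xi k w else 0).

Lemma random_coef_ge0 a w k i : 0 <= a -> 0 <= random_coef a w k i.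
Proof.
move=> a0; rewrite mulr_ge0//; case: ifPn => // k0.
by have [->|->] := xi_01 k0 w.
Qed.

Lemma measurable_riesz a N m :
  measurable_fun [set: T] (fun w => riesz (random_coef a w) N m).
Proof.
elim: N m => [|N IH] m; first exact: measurable_cst.
apply: measurable_funD => //; apply: measurable_sum => i.
by do 2 apply: measurable_funM => //.
Qed.

(** The extra product over indices above [N] is what the induction needs: expanding the factor
    [N.+1] moves [xi N.+1] into the list [s], and all indices stay distinct. *)
Lemma expectation_riesz a N m (s : seq nat) : 0 <= a -> uniq s ->
  (forall k, k \in s -> (N < k)%N) ->
  (\int[P]_w (riesz (random_coef a w) N m * \prod_(k <- s) xi k w)%:E =
   (riesz (fun k _ => a * delta k) N m * \prod_(k <- s) delta k)%:E)%E.
Proof.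
move=> a0; elim: N m s => [|N IH] m s us sN.
  under eq_integral do rewrite EFinM.
  rewrite ge0_integralZl_EFin//; last 2 first.
  - move=> w _; rewrite lee_fin big_seq prodr_ge0// => k /sN k0.
    by have [->|->] := xi_01 k0 w.
  - by apply/measurable_EFinP; apply: measurable_prod => k _.
  by rewrite expectation_prod// EFinM.
have prod_ge0 w : 0 <= \prod_(k <- s) xi k w.
  rewrite big_seq prodr_ge0// => k /sN /(leq_ltn_trans (leq0n _)) k0.
  by have [->|->] := xi_01 k0 w.
have mprod : measurable_fun [set: T] (fun w => \prod_(k <- s) xi k w).
  by apply: measurable_prod.
have riesz0 n w : 0 <= riesz (random_coef a w) N n.
  by apply: riesz_ge0 => k i; exact: random_coef_ge0.
have xi0 w : 0 <= xi N.+1 w by have [->|->] := xi_01 (ltn0Sn N) w.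
have -> : (fun w => (riesz (random_coef a w) N.+1 m * \prod_(k <- s) xi k w)%:E) =
  (fun w => (riesz (random_coef a w) N m * \prod_(k <- s) xi k w)%:E +
    \sum_(i <- shifts) a%:E * (riesz (random_coef a w) N (m - i * N.+1%:Z) *
      \prod_(k <- N.+1 :: s) xi k w)%:E)%E.
  apply/funext => w; rewrite rieszS mulrDl EFinD mulr_suml -sumEFin.
  congr (_ + _)%E; apply: eq_bigr => i _.
  by rewrite -EFinM big_cons /random_coef/=; congr EFin; ring.
have mt n : measurable_fun [set: T] (fun w => (riesz (random_coef a w) N n *
      \prod_(k <- N.+1 :: s) xi k w)%:E).
  apply/measurable_EFinP; apply: measurable_funM; first exact: measurable_riesz.
  exact: measurable_prod.
have t0 n w : (0 <= (riesz (random_coef a w) N n *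
      \prod_(k <- N.+1 :: s) xi k w)%:E)%E.
  by rewrite lee_fin big_cons !mulr_ge0.
rewrite ge0_integralD//; last 4 first.
- by move=> w _; rewrite lee_fin mulr_ge0.
- apply/measurable_EFinP; apply: measurable_funM => //; exact: measurable_riesz.
- by move=> w _; apply: sume_ge0 => i _; rewrite mule_ge0.
- by apply: emeasurable_sum => i _; apply: measurable_funeM.
rewrite IH//; last by move=> k /sN /ltnW.
rewrite ge0_integral_sum//; last 2 first.
- by move=> i; apply: measurable_funeM.
- by move=> i w _; rewrite mule_ge0.
rewrite rieszS mulrDl EFinD mulr_suml -sumEFin; congr (_ + _)%E.
apply: eq_bigr => i _; rewrite ge0_integralZl_EFin// IH//; last 2 first.
- by rewrite /= us andbT; apply/negP => /sN; rewrite ltnn.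
- by move=> k; rewrite inE => /orP[/eqP -> //|/sN /ltnW].
by rewrite -EFinM big_cons; congr EFin; ring.
Qed.

(** The zeroth coefficients increase with [N] and their means are at most [B], so their limit is
    integrable, hence finite almost everywhere. *)
Lemma ae_riesz_bounded a B : 0 <= a ->
  (forall N, riesz (fun k _ => a * delta k) N 0 <= B) ->
  {ae P, forall w, exists C, forall N, riesz (random_coef a w) N 0 <= C}.
Proof.
move=> a0 rB.
pose g N w := (riesz (random_coef a w) N 0)%:E.
have mg N : measurable_fun [set: T] (g N).
  by apply/measurable_EFinP; exact: measurable_riesz.
have g0 N w : (0 <= g N w)%E.
  by rewrite lee_fin; apply: riesz_ge0 => k i; exact: random_coef_ge0.
have gnd w : {homo g^~ w : N N' / (N <= N')%N >-> (N <= N')%E}.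
  by move=> N N' NN'; rewrite lee_fin riesz_nd// => k i; exact: random_coef_ge0.
have mlim : measurable_fun [set: T] (fun w => limn (g^~ w)).
  apply: (emeasurable_fun_cvg g) => // w _.
  by apply: ereal_nondecreasing_is_cvgn.
have lim0 w : (0 <= limn (g^~ w))%E.
  apply: lime_ge; first exact: ereal_nondecreasing_is_cvgn.
  exact: nearW.
have : P.-integrable [set: T] (fun w => limn (g^~ w)).
  apply/integrableP; split => //.
  under eq_integral do rewrite gee0_abs//.
  rewrite monotone_convergence//.
  apply: (@le_lt_trans _ _ B%:E); last exact: ltry.
  apply: lime_le.
    apply: ereal_nondecreasing_is_cvgn => N N' NN'.
    by apply: ge0_le_integral => // w _; exact: gnd.
  apply: nearW => N.
  rewrite [leLHS](_ : _ = \int[P]_w (riesz (random_coef a w) N 0 *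
      \prod_(k <- [::]) xi k w)%:E)%E; last first.
    by apply: eq_integral => w _; rewrite big_nil mulr1.
  by rewrite expectation_riesz// big_nil mulr1 lee_fin.
move=> /(integrable_ae measurableT); apply: filterS => w /(_ I) fin.
exists (fine (limn (g^~ w))) => N.
rewrite -lee_fin fineK//; apply: lime_ge; first exact: ereal_nondecreasing_is_cvgn.
by exists N => // n /= Nn; exact: gnd.
Qed.

End random_riesz.

(** * Cosine coefficients and Fejer means *)

Section cosine_integrals.
Variable R : realType.
Let mu := @lebesgue_measure R.
Implicit Types (h : R -> R) (M x y : R).

Lemma measurable_cosm m : measurable_fun [set: R] (@cosm R m).
Proof. by apply: continuous_measurable_fun; exact: continuous_cosm. Qed.

Lemma lebesgue_measure01 : mu (`[0, 1]%classic : set R) = 1%:E.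
Proof. by rewrite /mu lebesgue_measure_itv/= lte_fin ltr01 -EFinD subr0. Qed.

Lemma integrable01_bounded h M : measurable_fun [set: R] h ->
  (forall x, `|h x| <= M) -> mu.-integrable `[0, 1] (EFin \o h).
Proof.
move=> mh hM; apply: measurable_bounded_integrable => //.
- by rewrite [X in (X < _)%E]lebesgue_measure01 ltry.
- exact: measurable_funTS.
- exists M; split; first exact: num_real.
  by move=> N MN x _ /=; exact: le_trans (hM x) (ltW MN).
Qed.

Lemma sin2pi_int (z : int) : sin (2 * pi * z%:~R) = 0 :> R.
Proof.
have sn n : sin (2 * pi * n%:R) = 0 :> R.
  by rewrite -[2 * pi * _]add0r sinD2pin sin0.
by case: (intP z) => [|n|n]; rewrite ?rmorphN/= ?mulrN ?sinN -?pmulrn sn ?oppr0.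
Qed.

Lemma integral_cosm m : \int[mu]_(x in `[0, 1]) cosm m x = (m == 0)%:R :> R.
Proof.
have [->|m0] := eqVneq m 0.
  rewrite (@eq_Rintegral _ _ _ mu _ (fun=> 1)); last by move=> x _; rewrite cosm0.
  by rewrite Rintegral_cst// [X in fine X]lebesgue_measure01 mul1r.
pose c : R := 2 * pi * m%:~R.
have c0 : c != 0 by rewrite mulf_neq0 ?intr_eq0// mulf_neq0// gt_eqF// pi_gt0.
pose F x := c^-1 * sin (c * x).
have dF x : is_derive x 1 F (cosm m x).
  have h1 : is_derive x (1 : R) (c \*: (@id R)) (c *: 1).
    exact: is_deriveZ.
  have h2 := is_derive1_comp (is_derive_sin (c *: x)) h1.
  have h3 : is_derive x (1 : R) (c^-1 \*: (sin \o (c \*: (@id R))))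
    (c^-1 *: (cos (c *: x) * (c *: 1))) by exact: is_deriveZ.
  have -> : F = c^-1 \*: (sin \o (c \*: (@id R))) by [].
  apply: is_derive_eq.
  by rewrite /GRing.scale/= mulr1 mulrCA mulVf// mulr1 /cosm mulrA.
rewrite /Rintegral (@continuous_FTC2 _ _ F)//.
- by rewrite /F mulr0 sin0 mulr1 sin2pi_int mulr0 sube0.
- by apply: continuous_in_subspaceT => x ?; exact: continuous_cosm.
- have cF : continuous F.
    by move=> x; apply: differentiable_continuous; apply/derivable1_diffP; have [] := dF x.
  split.
  + by move=> x _; have [] := dF x.
  + by apply: cvg_at_right_filter; exact: cF.
  + by apply: cvg_at_left_filter; exact: cF.
- by move=> x x01; rewrite derive1E; apply: derive_val.
Qed.

Definition cos_coef h m : R := \int[mu]_(x in `[0, 1]) (h x * cosm m x).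

Lemma cos_coefN h m : cos_coef h (- m) = cos_coef h m.
Proof. by apply: eq_Rintegral => x _; rewrite cosmN. Qed.

(** The product of cosines is half the sum of unnormalised Fejer kernels at [x - y] and [x + y], and
    each such kernel is the squared modulus of [\sum_k e^(2 i pi k z)]. *)
Lemma fejer_kernel_ge0 n x y :
  0 <= \sum_(k < n) \sum_(l < n) cosm (k%:Z - l%:Z) x * cosm (k%:Z - l%:Z) y :> R.
Proof.
have K0 z : 0 <= \sum_(k < n) \sum_(l < n) cosm (k%:Z - l%:Z) z :> R.
  have -> : \sum_(k < n) \sum_(l < n) cosm (k%:Z - l%:Z) z =
      (\sum_(k < n) cos (2 * pi * (k%:R * z))) ^+ 2 +
      (\sum_(k < n) sin (2 * pi * (k%:R * z))) ^+ 2.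
    rewrite !expr2 !mulr_suml -big_split/=; apply: eq_bigr => k _.
    rewrite !mulr_sumr -big_split/=; apply: eq_bigr => l _.
    rewrite -cosB /cosm rmorphB/= -!pmulrn; congr cos; ring.
  by rewrite addr_ge0// sqr_ge0.
have -> : \sum_(k < n) \sum_(l < n) cosm (k%:Z - l%:Z) x * cosm (k%:Z - l%:Z) y =
    2^-1 * (\sum_(k < n) \sum_(l < n) cosm (k%:Z - l%:Z) (x - y) +
            \sum_(k < n) \sum_(l < n) cosm (k%:Z - l%:Z) (x + y)).
  rewrite -big_split/= mulr_sumr; apply: eq_bigr => k _.
  rewrite -big_split/= mulr_sumr; apply: eq_bigr => l _.
  rewrite /cosm; set a := 2 * pi * (_ * x); set b := 2 * pi * (_ * y).
  rewrite (_ : 2 * pi * (_ * (x - y)) = a - b); last by rewrite /a /b; ring.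
  rewrite (_ : 2 * pi * (_ * (x + y)) = a + b); last by rewrite /a /b; ring.
  by rewrite cosB cosD; field.
by rewrite mulr_ge0// addr_ge0.
Qed.

(** The double sum is the integral of [h] against a non-negative kernel. With [h] replaced by the
    constant [M], only the [n] diagonal terms survive. *)
Lemma fejer_mean_le h M n y : measurable_fun [set: R] h ->
  (forall x, `|h x| <= M) ->
  `|\sum_(k < n) \sum_(l < n) cos_coef h (k%:Z - l%:Z) * cosm (k%:Z - l%:Z) y|
     <= n%:R * M.
Proof.
move=> mh hM.
have M0 : 0 <= M by exact: le_trans (normr_ge0 _) (hM 0).
pose D : set R := `[0, 1]%classic.
have mD : measurable (D : set (measurableTypeR R)) by exact: measurable_itv.
pose K x := \sum_(k < n) \sum_(l < n) cosm (k%:Z - l%:Z) x * cosm (k%:Z - l%:Z) y.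
have K0 x : 0 <= K x by exact: fejer_kernel_ge0.
(* Stated for a general [g] because it serves both [h] and the constant [M]. *)
have KE (g : R -> R) : measurable_fun [set: R] g -> (forall x, `|g x| <= M) ->
    mu.-integrable D (EFin \o (fun x => g x * K x)) /\
    \int[mu]_(x in D) (g x * K x) = \sum_(k < n) \sum_(l < n)
      (\int[mu]_(x in D) (g x * cosm (k%:Z - l%:Z) x)) * cosm (k%:Z - l%:Z) y.
  move=> mg gM.
  have mgc m : measurable_fun [set: R] (fun x => g x * cosm m x).
    by apply: measurable_funM => //; exact: measurable_cosm.
  have igc m : mu.-integrable D (EFin \o (fun x => g x * cosm m x)).
    apply: (@integrable01_bounded _ M) => // x.
    by rewrite normrM (le_trans (ler_piMr _ (cosm_le1 _ _))).
  have igcc m : mu.-integrable D (EFin \o (fun x => g x * cosm m x * cosm m y)).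
    have -> : EFin \o (fun x => g x * cosm m x * cosm m y) =
      (fun x => (g x * cosm m x)%:E * (cosm m y)%:E)%E by [].
    apply: (@integrableZr _ _ _ mu D _ (cosm m y) _ (igc m)).
    exact: measurable_itv.
  have gK : (fun x => g x * K x) = (fun x => \sum_(k < n) \sum_(l < n)
      (g x * cosm (k%:Z - l%:Z) x * cosm (k%:Z - l%:Z) y)).
    apply/funext => x; rewrite /K mulr_sumr; apply: eq_bigr => k _.
    by rewrite mulr_sumr; apply: eq_bigr => l _; rewrite mulrA.
  have Rsum (I : Type) (s : seq I) (f : I -> R -> R) :
      (forall i, mu.-integrable D (EFin \o f i)) ->
      mu.-integrable D (EFin \o (fun x => \sum_(i <- s) f i x)) /\
      \int[mu]_(x in D) (\sum_(i <- s) f i x) = \sum_(i <- s) \int[mu]_(x in D) f i x.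
    move=> fi; elim: s => [|i s [IH1 IH2]].
      split; first by under eq_fun do rewrite big_nil; exact: integrable0.
      rewrite big_nil (@eq_Rintegral _ _ _ mu _ (fun=> 0)); last first.
        by move=> x _; rewrite big_nil.
      rewrite Rintegral_cst ?mul0r//; exact: measurable_itv.
    split.
      have -> : EFin \o (fun x => \sum_(i <- i :: s) f i x) =
          (fun x => (EFin \o f i) x + (EFin \o (fun x => (\sum_(i <- s) f i x)%R)) x)%E.
        by apply/funext => x /=; rewrite big_cons EFinD.
      by apply: integrableD => //; exact: measurable_itv.
    under eq_Rintegral do rewrite big_cons.
    rewrite RintegralD; [|exact: measurable_itv|exact: fi|exact: IH1].
    by rewrite big_cons -IH2.
  have inner (k : 'I_n) := Rsum _ (index_enum 'I_n)
    (fun (l : 'I_n) x => g x * cosm (k%:Z - l%:Z) x * cosm (k%:Z - l%:Z) y)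
    (fun l => igcc _).
  have [intS intSE] := Rsum _ (index_enum 'I_n) _ (fun k : 'I_n => (inner k).1).
  rewrite gK; split => //; rewrite intSE; apply: eq_bigr => k _.
  rewrite (inner k).2; apply: eq_bigr => l _.
  by rewrite RintegralZr; [|exact: measurable_itv|exact: igc].
have ler_norm_cst : `|M| <= M by rewrite ger0_norm.
have [ihK hKE] := KE h mh hM.
have [iMK MKE] := KE (cst M) (measurable_cst _) (fun=> ler_norm_cst).
rewrite -hKE (le_trans (le_normr_Rintegral mD ihK))//.
apply: (@le_trans _ _ (\int[mu]_(x in D) (M * K x))).
  apply: le_Rintegral => //.
    by have := integrable_norm ihK.
  by move=> x _; rewrite normrM (ger0_norm (K0 _)) ler_wpM2r.
have intM m : \int[mu]_(x in D) (cst M x * cosm m x) = M * (m == 0)%:R.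
  rewrite RintegralZl// ?integral_cosm//.
  by apply: (integrable01_bounded (M := 1) (measurable_cosm _)); exact: cosm_le1.
rewrite MKE (eq_bigr (fun=> M)).
  by rewrite sumr_const card_ord mulr_natl.
move=> k _; rewrite (bigD1 k)//= big1 ?addr0.
  by rewrite intM subrr eqxx cosm0 !mulr1.
move=> l lk; rewrite intM subr_eq0 eqz_nat [_ == _](_ : _ = false) ?mulr0 ?mul0r//.
by apply/negbTE; rewrite eq_sym.
Qed.

End cosine_integrals.

(** * Sets with bounded Riesz coefficients *)

Section riesz_extra.
Variable R : realType.

Lemma riesz_lin1 (b1 : nat -> R) N m :
  riesz_lin (fun k i => if `|i|%N == 1%N then b1 k else 0) N m =
  if (0 < `|m| <= N)%N then b1 `|m|%N else 0.
Proof.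
have E k : (0 < k)%N -> \sum_(i <- shifts)
    (if `|i|%N == 1%N then b1 k else 0) * (m == i * k%:Z)%:R =
    if k == `|m|%N then b1 k else 0.
  move=> k0; rewrite /shifts !big_cons big_nil/= !mul0r !addr0 mul1r mulN1r.
  have [km|km] := eqVneq k `|m|%N.
    have [m0|m0] := leP 0 m.
      have -> : (m == k) by lia.
      have -> : (m == - k%:Z) = false by lia.
      by rewrite mulr1 mulr0 addr0.
    have -> : (m == k) = false by lia.
    have -> : (m == - k%:Z) by lia.
    by rewrite mulr1 mulr0 add0r.
  have -> : (m == k) = false by lia.
  have -> : (m == - k%:Z) = false by lia.
  by rewrite !mulr0 addr0.
rewrite /riesz_lin (eq_big_nat _ _ (F2 := fun k => if k == `|m|%N then b1 k else 0)); last first.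
  by move=> k /andP[k0 _]; exact: E.
rewrite -big_mkcond big_nat1_eq.
by rewrite ltnS.
Qed.

Lemma rieszN (b : nat -> int -> R) N m : shift_sym b -> riesz b N (- m) = riesz b N m.
Proof.
move=> bs; pose Q := (`|m| + N * N.+1).+1.
rewrite -(@avg_rieszP _ b N Q m)// -(@avg_rieszP _ b N Q (- m))// ?abszN//.
by apply: eq_avg => x; rewrite cosmN.
Qed.

(** Keep only [l < n] and [l <= k < l + n]: for each such [l] the difference [k - l] runs over
    [0, ..., n - 1]. *)
Lemma half_square_sum_le (F : nat -> R) n : (forall j, 0 <= F j) ->
  n%:R * (\sum_(j < n) F j) <=
  \sum_(k < n.*2) \sum_(l < n.*2) F `|k%:Z - l%:Z|%N.
Proof.
move=> F0; rewrite exchange_big/= -addnn big_split_ord/=.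
rewrite -[leLHS]addr0 lerD//; last first.
  by apply: sumr_ge0 => l _; apply: sumr_ge0.
rewrite mulr_natl -[X in _ *+ X]card_ord -sumr_const; apply: ler_sum => l _.
rewrite -!(big_mkord xpredT (fun k => F `|k%:Z - l%:Z|%N)) -(big_mkord xpredT F)/=.
rewrite [leRHS](@big_cat_nat _ _ _ l)//=; last by rewrite (leq_trans (ltnW (ltn_ord l)))// leq_addr.
rewrite [X in _ + X](@big_cat_nat _ _ _ (n + l) l)//=; last 2 first.
- exact: leq_addl.
- by rewrite leq_add2l ltnW.
rewrite -[leLHS]add0r lerD ?sumr_ge0// -[leLHS]addr0 lerD ?sumr_ge0//.
rewrite -{1}[l : nat]add0n big_addn addnK; apply: ler_sum => k _.
by rewrite PoszD addrK.
Qed.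

End riesz_extra.

Section bounded_riesz.
Variables (R : realType) (a B : R) (y : nat -> R).
Hypothesis a_gt0 : 0 < a.
Hypothesis a_le : 4 * a <= 1.
Hypothesis y01 : forall k, y k = 0 \/ y k = 1.
Hypothesis rB : forall N, riesz (fun k _ => a * y k) N 0 <= B.
Let c (k : nat) (_ : int) : R := a * y k.

Lemma zero_one_ge0 k : 0 <= y k. Proof. by have [->|->] := y01 k. Qed.
Lemma zero_one_le1 k : y k <= 1. Proof. by have [->|->] := y01 k. Qed.

Lemma riesz_le_bound N m : riesz c N m <= B.
Proof.
apply: le_trans (rB N); apply: riesz_le0 => // k _.
apply: le_trans a_le; rewrite (eq_bigr (fun=> a * y k)); last first.
  by move=> i _; rewrite ger0_norm// mulr_ge0 ?zero_one_ge0// ltW.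
rewrite /shifts !big_cons big_nil.
by have [->|->] := y01 k; rewrite ?mulr0 ?mulr1; have := a_gt0; lra.
Qed.

Lemma riesz_bound_ge1 : 1 <= B.
Proof. exact: (rB 0%N). Qed.

Lemma norm_riesz_le (b : nat -> int -> R) N m :
  (forall k i, `|b k i| <= c k i) -> `|riesz b N m| <= B.
Proof.
by move=> bc; apply: le_trans (riesz_le_bound N m); apply: riesz_dominated => k i _.
Qed.

Lemma norm_riesz_remainder (b : nat -> int -> R) (l : R) N m : 0 <= l -> l <= 1 ->
  (forall k i, `|b k i| <= l * c k i) ->
  `|riesz b N m - (m == 0)%:R - riesz_lin b N m| <= l ^+ 2 * B.
Proof.
move=> l0 l1 bc; apply: (le_trans (@riesz_remainder _ b c _ _ _ l0 l1 _ _)) => //.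
  by move=> k i; rewrite mulr_ge0 ?zero_one_ge0// ltW.
by rewrite ler_wpM2l ?exprn_ge0// riesz_le_bound.
Qed.

(** Duality: the Fejer sum of [A] is averaged against a non-negative Riesz product whose linear part
    has the signs of [A]. The product has mean at most [B], which bounds the average above; below,
    each [A j] contributes at least a fixed multiple of its absolute value. *)
Lemma fejer_bound_sum (A : nat -> R) M n : 0 <= M ->
  (forall k, y k = 0 -> A k = 0) -> A 0%N = 0 ->
  (forall x, `|\sum_(k < n.*2) \sum_(l < n.*2)
     A `|k%:Z - l%:Z|%N * cosm (k%:Z - l%:Z) x| <= n.*2%:R * M) ->
  \sum_(j < n) `|A j| <= 8 * B ^+ 2 / a ^+ 2 * M.
Proof.
move=> M0 Ay A0 HM.
have B0 : 0 < B by exact: lt_le_trans riesz_bound_ge1.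
(* This [l] maximises [l * a - l ^ 2 * B], linear gain minus remainder; the maximum is
   [a ^ 2 / (4 * B)]. *)
pose l := a / (2 * B).
have l0 : 0 <= l by rewrite divr_ge0 ?mulr_ge0 ?(ltW a_gt0) ?(ltW B0).
have l1 : l <= 1.
  by rewrite ler_pdivrMr ?mulr_gt0// mul1r; have := riesz_bound_ge1; have := a_le; lra.
pose b1 k := l * (a * y k) * Num.sg (A k).
pose b (k : nat) (i : int) := if `|i|%N == 1%N then b1 k else 0.
have bs : shift_sym b by move=> k i; rewrite /b abszN.
have bc k i : `|b k i| <= l * c k i.
  have lc : 0 <= l * (a * y k)
    by apply: mulr_ge0 => //; apply: mulr_ge0; [exact: ltW|exact: zero_one_ge0].
  rewrite /b; case: ifP => _; last by rewrite normr0.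
  rewrite normrM (ger0_norm lc) ler_piMr// normr_sg.
  by case: (_ != 0).
have bc' k i : `|b k i| <= c k i.
  by apply: (le_trans (bc k i)); rewrite ler_piMl// mulr_ge0 ?zero_one_ge0// ltW.
pose N := n.*2; have [Q QE] : exists Q, Q = (N + N * N.+1).+1 by eexists.
pose H x := \sum_(k < N) \sum_(l < N) A `|k%:Z - l%:Z|%N * cosm (k%:Z - l%:Z) x.
have b_ge0 x : 0 <= rieszP b N x.
  apply: rieszP_ge0 => k _; apply: (@le_trans _ _ (\sum_(i <- shifts) a)).
    apply: ler_sum => i _; apply: (le_trans (bc' k i)).
    by rewrite ler_piMr ?zero_one_le1// ltW.
  by rewrite /shifts !big_cons big_nil; have := a_le; lra.
have up : avg Q (fun x => rieszP b N x * H x) <= N%:R * M * B.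
  apply: (@le_trans _ _ (avg Q (fun x => N%:R * M * (rieszP b N x * cosm 0 x)))).
    apply: ler_avg => x; rewrite cosm0 mulr1 mulrC ler_wpM2r//.
    exact: le_trans (ler_norm _) (HM x).
  have NM0 : 0 <= N%:R * M by exact: le_trans (normr_ge0 _) (HM 0).
  rewrite avgZ ler_wpM2l// avg_rieszP//; last by rewrite QE add0n ltnS leq_addl.
  by rewrite (le_trans (ler_norm _))// norm_riesz_le.
have riesz_abs (j : int) : riesz b N j = riesz b N `|j|%N.
  have [j0|j0] := leP 0 j; first by rewrite gez0_abs.
  by rewrite -[in LHS](opprK j) rieszN// -lez0_abs// ltW.
have low (j : nat) : (j <= N)%N -> a ^+ 2 / (4 * B) * `|A j| <= A j * riesz b N j.
  move=> jN; have [A0j|Aj0] := eqVneq (A j) 0.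
    by rewrite A0j normr0 mulr0 mul0r.
  have yj : y j = 1 by have [/Ay /eqP|//] := y01 j; rewrite (negPf Aj0).
  have j0 : (0 < j)%N by rewrite lt0n; apply: contra Aj0 => /eqP ->; rewrite A0.
  have := norm_riesz_remainder N j%:Z l0 l1 bc.
  rewrite riesz_lin1/= j0 jN/= eqz_nat gtn_eqF// subr0 /b1 yj mulr1 => hr.
  have : A j * riesz b N j >= `|A j| * (l * a) - `|A j| * (l ^+ 2 * B).
    have -> : A j * riesz b N j = `|A j| * (l * a) +
        A j * (riesz b N j - l * a * Num.sg (A j)).
      by rewrite [in RHS]normrEsg; ring.
    rewrite lerD2l lerNl -mulrN (le_trans (ler_norm _))// normrM normrN ler_wpM2l//.
  apply: le_trans; rewrite -mulrBr mulrC ler_wpM2l//.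
  rewrite /l le_eqVlt; apply/orP; left; apply/eqP; field.
  by rewrite gt_eqF.
have : a ^+ 2 / (4 * B) * (\sum_(k < N) \sum_(l < N) `|A `|k%:Z - l%:Z|%N|) <= N%:R * M * B.
  apply: le_trans up.
  have -> : avg Q (fun x => rieszP b N x * H x) =
      \sum_(k < N) \sum_(l < N) A `|k%:Z - l%:Z|%N * riesz b N `|k%:Z - l%:Z|%N.
    rewrite (@eq_avg _ _ _ (fun x => \sum_(k < N) \sum_(l < N)
       A `|k%:Z - l%:Z|%N * (rieszP b N x * cosm (k%:Z - l%:Z) x))); last first.
      move=> x; rewrite /H mulr_sumr; apply: eq_bigr => k _.
      by rewrite mulr_sumr; apply: eq_bigr => l' _; rewrite mulrCA.
    rewrite avg_sum; apply: eq_bigr => k _; rewrite avg_sum; apply: eq_bigr => l' _.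
    rewrite avgZ; congr (_ * _); rewrite -riesz_abs; apply: avg_rieszP => //.
    have kl : (absz (k%:Z - l'%:Z)%R <= N)%N.
      by have := ltn_ord k; have := ltn_ord l'; lia.
    by rewrite QE ltnS leq_add2r.
  rewrite mulr_sumr; apply: ler_sum => k _; rewrite mulr_sumr; apply: ler_sum => l' _.
  by apply: low; have := ltn_ord k; have := ltn_ord l'; lia.
move=> h; have [n00|n0] := posnP n.
  rewrite n00 big_ord0; apply: mulr_ge0 => //.
  by apply: divr_ge0; [apply: mulr_ge0 => //|]; exact: sqr_ge0.
have h2 := @half_square_sum_le R (fun j => `|A j|) n (fun=> normr_ge0 _).
have n0R : 0 < n%:R :> R by rewrite ltr0n.
have : a ^+ 2 / (4 * B) * (n%:R * \sum_(j < n) `|A j|) <= n.*2%:R * M * B.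
  apply: le_trans h; rewrite ler_wpM2l// divr_ge0 ?sqr_ge0// mulr_ge0// ltW//.
rewrite -muln2 natrM.
set S := \sum_(j < n) _ => h3.
have : (a ^+ 2 / (4 * B)) * S <= 2 * M * B.
  rewrite -(ler_pM2l n0R); move: h3; congr (_ <= _); by ring.
rewrite mulrAC ler_pdivrMr ?mulr_gt0// => h4.
rewrite mulrAC ler_pdivlMr ?exprn_gt0// mulrC (le_trans h4)//.
by rewrite le_eqVlt; apply/orP; left; apply/eqP; ring.
Qed.

End bounded_riesz.

(** * Points with negative averages *)

(** With [v = s - 2 * s ^ 2], multiply by [1 - v > 0]: the left side becomes at most 1 because
    [1 - v <= expR (- v)], the right side is [1 + s ^ 2 * (1 + 2 * s)]. *)
Lemma expR_le1D (R : realType) (s : R) : `|s| <= 2^-1 -> expR (s - 2 * s ^+ 2) <= 1 + s.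
Proof.
rewrite ler_norml => /andP[s1 s2].
have h : 0 < 1 - (s - 2 * s ^+ 2) by nra.
have : 1 - (s - 2 * s ^+ 2) <= expR (- (s - 2 * s ^+ 2)) by exact: expR_ge1Dx.
rewrite expRN => h2.
have e0 := expR_gt0 (s - 2 * s ^+ 2).
have : (1 - (s - 2 * s ^+ 2)) * expR (s - 2 * s ^+ 2) <= 1.
  by rewrite -ler_pdivlMr// div1r.
move=> h3; rewrite -(ler_pM2l h) (le_trans h3)//.
have -> : (1 - (s - 2 * s ^+ 2)) * (1 + s) = 1 + s ^+ 2 * (1 + 2 * s) by ring.
by rewrite lerDl mulr_ge0 ?sqr_ge0//; lra.
Qed.

Lemma ler_avg01 (R : realType) Q (f g : R -> R) : (forall x, 0 <= x <= 1 -> f x <= g x) ->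
  avg Q f <= avg Q g.
Proof.
move=> fg; rewrite ler_wpM2l ?invr_ge0// ler_sum// => k _; apply: fg.
have Q0 : (0 < Q)%N by apply: leq_ltn_trans (ltn_ord k).
by rewrite divr_ge0//= ler_pdivrMr ?ltr0n// mul1r ler_nat ltnW.
Qed.

Section not_equidistributed.
Variables (R : realType) (a B : R) (y : nat -> R).
Hypothesis a_gt0 : 0 < a.
Hypothesis a_le : 4 * a <= 1.
Hypothesis y01 : forall k, y k = 0 \/ y k = 1.
Hypothesis rB : forall N, riesz (fun k _ => a * y k) N 0 <= B.
Variable n : nat -> nat.
Hypothesis n_incr : increasing_seq n.
Hypothesis n_range : range n = [set k | y k = 1].
Hypothesis y0 : y 0%N = 0.

Let n_lt i j : (n i < n j)%N = (i < j)%N.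
Proof. by have /(_ i j) := leW_mono n_incr. Qed.

Let n_le i j : (n i <= n j)%N = (i <= j)%N.
Proof. exact: n_incr. Qed.

Let y_n i : y (n i) = 1.
Proof. by have : range n (n i) by [exists i]; rewrite n_range. Qed.

Let n_gt0 i : (0 < n i)%N.
Proof.
rewrite lt0n; apply/eqP => ni0; have := y_n i; rewrite ni0 y0 => /eqP.
by rewrite eq_sym oner_eq0.
Qed.

Let y_eq0 k : (forall j, n j <> k) -> y k = 0.
Proof.
move=> nk; have [//|y1] := y01 k.
have : range n k by rewrite n_range.
by case=> j _ /nk.
Qed.

Lemma sum_range (g : nat -> R) K :
  \sum_(1 <= i < n K) y i * g i = \sum_(j < K) g (n j).
Proof.
elim: K => [|K IH].
  rewrite big_ord0 big_nat big1// => i /andP[_ iK].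
  rewrite y_eq0 ?mul0r// => j nj; move: iK; rewrite -nj n_lt ltn0 //.
rewrite big_ord_recr/= -IH (@big_cat_nat _ _ _ (n K))//=; last first.
  by rewrite ltnW// n_lt.
congr (_ + _); rewrite big_ltn ?n_lt// y_n mul1r [X in _ + X](_ : _ = 0) ?addr0//.
rewrite big_nat big1// => i /andP[Ki iK].
rewrite y_eq0 ?mul0r// => j nj; move: Ki iK; rewrite -nj !n_lt ltnS.
by move=> h1 h2; have := leq_trans h1 h2; rewrite ltnn.
Qed.

Let B1 : 1 <= B. Proof. exact: riesz_bound_ge1 rB. Qed.
Let B0 : 0 < B. Proof. exact: lt_le_trans B1. Qed.

(** Amplitude of the density [prod (1 - t * y k * cos (2 pi k x))], chosen so that its coefficients
    are [l * (a * y k)] in size with [l = 1 / (2 * B)], and the remainder [l ^ 2 * B] is at most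
    [1 / 4]. *)
Let t := a / B.
(** Maximises the exponent per element [u * t / 4 - 8 * u ^ 2] obtained in [tilt_ge]; the maximum is
    [t ^ 2 / 512]. *)
Let u := t / 64.

Let t0 : 0 < t. Proof. exact: divr_gt0. Qed.
Let u0 : 0 < u. Proof. exact: divr_gt0. Qed.
Let ta : t <= a.
Proof. by rewrite ler_pdivrMr// ler_peMr// ltW. Qed.

Let z_le k x : `|cosm k%:Z x + t / 2| <= 2.
Proof.
have := cosm_le1 k%:Z x; rewrite !ler_norml => /andP[? ?]; apply/andP; split;
  by have := a_le; have := ta; have := t0; lra.
Qed.

Let uz_le k x : `|u * (cosm k%:Z x + t / 2)| <= 2^-1.
Proof.
rewrite normrM (ger0_norm (ltW u0)).
have u64 : u * 64 = t by rewrite /u; field.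
have := z_le k x; have := u0; have := ta; have := a_le.
have := normr_ge0 (cosm k%:Z x + t / 2); nra.
Qed.

(* Weight of the first K elements of the set: large where their cosine sum is not
   below [- t / 4 * K]. *)
Let tilt K (x : R) := \prod_(1 <= k < n K) (1 + u * (y k * (cosm k%:Z x + t / 2))).

(** Each factor [1 + s] with [s = u * z k] is at least [expR (s - 2 * s ^ 2)], and [z k ^ 2 <= 4]
    turns the loss into [8 * u ^ 2]. *)
Let tilt_ge K x : - (t / 4) * K%:R < \sum_(j < K) cosm (n j)%:Z x ->
  expR (t ^+ 2 / 512 * K%:R) <= tilt K x.
Proof.
move=> xK.
pose z k := cosm k%:Z x + t / 2.
have u64 : u * 64 = t by rewrite /u; field.
apply: (@le_trans _ _ (\prod_(1 <= k < n K) expR (y k * (u * z k - 8 * u ^+ 2)))); last first.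
  apply: ler_prod => k _; rewrite expR_ge0/=.
  have [->|->] := y01 k; first by rewrite !mul0r mulr0 addr0 expR0.
  rewrite !mul1r; have uz := uz_le k x.
  apply: le_trans (expR_le1D uz); rewrite ler_expR exprMn lerB//.
  have := z_le k x; rewrite -/(z k) ler_norml => /andP[z1 z2].
  have : z k ^+ 2 <= 4 by nra.
  have := sqr_ge0 u; nra.
rewrite -expR_sum ler_expR sum_range.
rewrite (eq_bigr (fun j : 'I_K => u * cosm (n j)%:Z x + (u * (t / 2) - 8 * u ^+ 2))); last first.
  by move=> j _; rewrite /z; ring.
rewrite big_split/= -mulr_sumr sumr_const card_ord -[X in _ <= _ + X]mulr_natr.
apply: (@le_trans _ _ (u * (- (t / 4) * K%:R) + (u * (t / 2) - 8 * u ^+ 2) * K%:R)).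
  by rewrite -u64 le_eqVlt; apply/orP; left; apply/eqP; field.
by rewrite lerD2r ler_pM2l// ltW.
Qed.

Let tilt_ge0 K x : 0 <= tilt K x.
Proof.
apply: prodr_ge0 => k _; have := uz_le k x; rewrite ler_norml => /andP[? ?].
have [->|->] := y01 k; first by rewrite mul0r mulr0 addr0.
by rewrite mul1r; lra.
Qed.

Let b (k : nat) (i : int) := if `|i|%N == 1%N then - (t / 2) * y k else 0.

(** With [c = cos (2 pi k x)], the product [(1 - t c) (1 + u (c + t / 2))] equals [1 + (u (1 - t ^ 2
    / 2) - t) c - (u t / 2) cos (4 pi k x)]. The shift [t / 2] keeps the constant term equal to 1,
    so density times tilt is again a Riesz product. *)
Let bK K (k : nat) (i : int) :=
  if (k < n K)%N then
    if `|i|%N == 1%N then (u * (1 - t ^+ 2 / 2) - t) / 2 * y k else - (u * t / 4) * y k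
  else b k i.

Let y_ge k : 0 <= y k. Proof. exact: zero_one_ge0 y01 k. Qed.

Let b_dom k i : `|b k i| <= (2 * B)^-1 * (a * y k).
Proof.
rewrite /b; case: ifP => _; last by rewrite normr0 mulr_ge0 ?mulr_ge0 ?invr_ge0 ?mulr_ge0// ltW.
rewrite normrM normrN (ger0_norm (y_ge k)) mulrA ler_wpM2r//.
rewrite gtr0_norm; last exact: divr_gt0.
by rewrite /t le_eqVlt; apply/orP; left; apply/eqP; field; rewrite gt_eqF.
Qed.

Let b_dom1 k i : `|b k i| <= a * y k.
Proof.
apply: (le_trans (b_dom k i)); rewrite ler_piMl ?mulr_ge0 ?(ltW a_gt0)//.
by rewrite invf_le1 ?mulr_gt0//; have := B1; lra.
Qed.

Let bK_dom K k i : `|bK K k i| <= a * y k.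
Proof.
rewrite /bK; case: ifP => _; last exact: b_dom1.
have u64 : u * 64 = t by rewrite /u; field.
have [h1 h2 h3 h4] : [/\ 0 < u, t <= a, 4 * a <= 1 & 0 < t] by [].
case: ifP => _; rewrite normrM (ger0_norm (y_ge k)) ler_wpM2r// ler_norml; apply/andP; split; nra.
Qed.

Let b_sym : shift_sym b. Proof. by move=> k i; rewrite /b abszN. Qed.
Let bK_sym K : shift_sym (bK K). Proof. by move=> k i; rewrite /bK /b abszN. Qed.

Let rieszP_tilt K J x : (K <= J)%N ->
  rieszP b (n J).-1 x * tilt K x = rieszP (bK K) (n J).-1 x.
Proof.
move=> KJ; rewrite /rieszP /tilt prednK//.
have nKJ : (n K <= n J)%N by rewrite n_le.
rewrite [X in _ * X](big_nat_widen _ _ (n J))// [X in _ * X]big_mkcond/= -big_split/=.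
apply: eq_bigr => k _; rewrite /bK /shifts !big_cons !big_nil /b/=.
case: ifP => _; last by rewrite mulr1.
rewrite !mulN1r !mulNr !cosmN !mul1r.
have := cosmM k%:Z k%:Z x; rewrite subrr cosm0.
have -> : k%:Z + k%:Z = 2 * k%:Z by rewrite mulrDl mul1r.
move=> e.
have -> : cosm (2 * k%:Z) x = 2 * (cosm k%:Z x * cosm k%:Z x) - 1 by rewrite e; field.
by have [->|->] := y01 k; field.
Qed.

(** The linear part does not contribute at frequency 0, so the mean differs from 1 by at most
    [1 / (4 * B)]. *)
Let avg_rieszP_ge N Q : (N * N.+1 < Q)%N -> 3 / 4 <= avg Q (rieszP b N).
Proof.
move=> NQ; have -> : avg Q (rieszP b N) = riesz b N 0.
  by rewrite -(@avg_rieszP _ b N Q)//; apply: eq_avg => x; rewrite cosm0 mulr1.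
have l0 : 0 <= (2 * B)^-1 by rewrite invr_ge0 mulr_ge0// ltW.
have l1 : (2 * B)^-1 <= 1 by rewrite invf_le1 ?mulr_gt0//; have := B1; lra.
have := norm_riesz_remainder a_gt0 a_le y01 rB N 0 l0 l1 b_dom.
rewrite /b riesz_lin1/= subr0 -/b.
have -> : (2 * B)^-1 ^+ 2 * B = (4 * B)^-1 by field; rewrite gt_eqF.
have : (4 * B)^-1 <= 4^-1 by rewrite lef_pV2 ?posrE ?mulr_gt0// ler_peMr.
by rewrite ler_norml => h /andP[h1 h2]; lra.
Qed.

Let avg_tilt_le J K Q : (K <= J)%N -> ((n J).-1 * (n J).-1.+1 < Q)%N ->
  avg Q (fun x => rieszP b (n J).-1 x * tilt K x) <= B.
Proof.
move=> KJ NQ; have -> : avg Q (fun x => rieszP b (n J).-1 x * tilt K x) =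
    riesz (bK K) (n J).-1 0.
  rewrite -(@avg_rieszP _ (bK K) (n J).-1 Q)//; apply: eq_avg => x.
  by rewrite cosm0 mulr1 rieszP_tilt.
rewrite (le_trans (ler_norm _))//.
exact: (norm_riesz_le a_gt0 a_le y01 rB _ _ (bK_dom K)).
Qed.

Let rieszPb_ge0 N x : 0 <= rieszP b N x.
Proof.
apply: rieszP_ge0 => k _; apply: (@le_trans _ _ (\sum_(i <- shifts) a)).
  apply: ler_sum => i _; apply: (le_trans (b_dom1 k i)).
  by rewrite ler_piMr ?(zero_one_le1 y01)// ltW.
by rewrite /shifts !big_cons big_nil; have := a_le; lra.
Qed.

(** Exponential Markov and union bounds: if every point failed for some [K] in the range, the
    density would be dominated by the sum of [r ^ K] times its tilts. Its mean, at least [3 / 4],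
    would then be at most [B * r ^ K0 / (1 - r)]. The choice of [K0] excludes this for all [J] at
    once. *)
Lemma finite_negative_averages : exists2 K0, (0 < K0)%N & forall J, exists2 x, 0 <= x <= 1 &
  forall K, (K0 <= K <= J)%N -> \sum_(j < K) cosm (n j)%:Z x <= - (t / 4) * K%:R.
Proof.
pose r := expR (- (t ^+ 2 / 512)).
have r0 : 0 < r by exact: expR_gt0.
have r1 : r < 1 by rewrite expR_lt1 oppr_lt0 divr_gt0 ?ltr0n ?exprn_gt0.
have r1' : 0 < 1 - r by rewrite subr_gt0.
have [K0 [K00 K0r]] : exists K0, (0 < K0)%N /\ B * r ^+ K0 < 3 / 4 * (1 - r).
  have : B * r ^+ k @[k --> \oo] --> B * 0.
    apply: cvgM; first exact: cvg_cst.
    by apply: cvg_expr; rewrite ger0_norm// ltW.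
  rewrite mulr0 => /cvgr_lt /(_ (3 / 4 * (1 - r))) h.
  have /h [K _ hK] : 0 < 3 / 4 * (1 - r) by rewrite mulr_gt0// divr_gt0.
  by exists K.+1; split => //; apply: hK; rewrite /= leqnSn.
exists K0 => // J; apply/not_exists2P => nex.
have bad x : 0 <= x <= 1 -> exists K, (K0 <= K < J.+1)%N /\
    - (t / 4) * K%:R < \sum_(j < K) cosm (n j)%:Z x.
  move=> x01; have [//|/existsNP[K /not_implyP[KJ /negP]]] := nex x.
  by rewrite -ltNge => h; exists K.
pose N := (n J).-1; have [Q QN] : exists Q, (N * N.+1 < Q)%N by exists (N * N.+1).+1.
have := avg_rieszP_ge QN; apply/negP; rewrite -ltNge.
apply: (@le_lt_trans _ _ (avg Q (fun x => \sum_(K0 <= K < J.+1)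
    r ^+ K * (rieszP b N x * tilt K x)))).
  apply: ler_avg01 => x /bad[K [KJ xK]].
  rewrite (bigD1_seq K) ?mem_index_iota ?iota_uniq//=.
  rewrite -[leLHS]addr0 lerD//; last first.
    apply: sumr_ge0 => K' _; rewrite mulr_ge0 ?exprn_ge0 ?(ltW r0)//.
    by rewrite mulr_ge0// tilt_ge0.
  rewrite mulrCA ler_peMr// -ler_pdivrMl ?exprn_gt0// mulr1.
  apply: le_trans (tilt_ge xK); rewrite /r -expRM_natl -expRN ler_expR.
  by rewrite mulrN opprK mulrC.
rewrite avg_sum big_nat.
apply: (@le_lt_trans _ _ (\sum_(K0 <= K < J.+1) r ^+ K * B)).
  rewrite [leRHS]big_nat; apply: ler_sum => K /andP[_ KJ].
  rewrite avgZ ler_wpM2l ?exprn_ge0 ?(ltW r0)//.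
  by apply: avg_tilt_le.
rewrite -mulr_suml -(ltr_pM2r r1') (le_lt_trans _ K0r)//.
rewrite -mulrA mulrC -mulrA ler_pM2l// mulrC.
have [K0J|/ltnW JK0] := leqP K0 J.+1; last by rewrite big_geq// mul0r exprn_ge0// ltW.
rewrite mulr_suml.
rewrite (eq_bigr (fun K => - (r ^+ K.+1 - r ^+ K))); last first.
  by move=> K _; rewrite exprS; ring.
by rewrite sumrN telescope_sumr// opprB lerBlDr lerDl exprn_ge0// ltW.
Qed.

(** A cluster point in [[0, 1]] of the points found for each [J] works: for fixed [K] the inequality
    is a closed condition, satisfied once [J >= K]. *)
Lemma negative_averages : exists2 K0, (0 < K0)%N & exists x, forall K, (K0 <= K)%N ->
  \sum_(j < K) cosm (n j)%:Z x <= - (t / 4) * K%:R.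
Proof.
have [K0 K00 neg] := finite_negative_averages; exists K0 => //.
pose S K (x : R) := \sum_(j < K) cosm (n j)%:Z x.
have [f f01 fS] : exists2 f : nat -> R, forall J, 0 <= f J <= 1 &
    forall J K, (K0 <= K <= J)%N -> S K (f J) <= - (t / 4) * K%:R.
  have /choice[f hf] : forall J, exists x, 0 <= x <= 1 /\
      forall K, (K0 <= K <= J)%N -> S K x <= - (t / 4) * K%:R.
    by move=> J; have [x x01 xJ] := neg J; exists x.
  by exists f => J; have [] := hf J.
have [x [_ xcl]] : (`[0, 1]%classic : set R) `&` cluster (f @ \oo) !=set0.
  apply: segment_compact; exists 0%N => // J _ /=; rewrite in_itv/=; exact: f01.
exists x => K K0K.
have cS K' : continuous (S K').
  elim: K' => [|K' IH] z.
    by rewrite (_ : S 0%N = fun=> 0); [exact: cvg_cst|apply/funext => ?; rewrite /S big_ord0].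
  rewrite (_ : S K'.+1 = fun x => S K' x + cosm (n K')%:Z x); last first.
    by apply/funext => ?; rewrite /S big_ord_recr.
  by apply: cvgD; [exact: IH|exact: continuous_cosm].
rewrite leNgt; apply/negP => Kx.
have near_x : nbhs x [set z | - (t / 4) * K%:R < S K z].
  by apply: (cvgr_gt _ (cS K x)).
have fK : (f @ \oo) [set z | S K z <= - (t / 4) * K%:R].
  by exists K => // J /= KJ; apply: fS; rewrite K0K.
have [z [/= zK]] := xcl _ _ fK near_x.
by rewrite ltNge zK.
Qed.

Lemma negative_average_not_int K0 x : (forall K, (K0 <= K)%N ->
    \sum_(j < K) cosm (n j)%:Z x <= - (t / 4) * K%:R) -> x \isn't a Num.int.
Proof.
move=> /(_ K0.+1 (leqnSn _)) h; apply/negP => xint; move: h.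
rewrite (eq_bigr (fun=> 1)); last by move=> j _; rewrite cosm_int.
rewrite sumr_const card_ord; apply/negP; rewrite -ltNge.
apply: (@lt_trans _ _ 0); last by rewrite ltr0n.
by rewrite mulNr oppr_lt0 mulr_gt0 ?ltr0n// divr_gt0.
Qed.

End not_equidistributed.

(** * The Sidon property and equidistribution *)

Section fourier_coefficients.
Variable R : realType.
Let mu := @lebesgue_measure R.
Implicit Types (h : R -> R) (f : R -> R[i]).

Definition sinm (m : int) (x : R) : R := sin (2 * pi * (m%:~R * x)).

Lemma sinmN m x : sinm (- m) x = - sinm m x.
Proof. by rewrite /sinm rmorphN mulNr mulrN sinN. Qed.

Lemma sinm_le1 m x : `|sinm m x| <= 1.
Proof. exact: sin_max. Qed.

Lemma measurable_sinm m : measurable_fun [set: R] (sinm m).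
Proof.
apply: continuous_measurable_fun => x.
rewrite (_ : sinm m = sin \o (fun y : R => 2 * pi * (m%:~R * y)))//.
apply: continuous_comp; last exact: continuous_sin.
by apply: cvgM; [exact: cvg_cst|apply: cvgM; [exact: cvg_cst|exact: cvg_id]].
Qed.

Definition sin_coef h m : R := \int[mu]_(x in `[0, 1]) (h x * sinm m x).

Lemma sin_coefN h m M : measurable_fun [set: R] h -> (forall x, `|h x| <= M) ->
  sin_coef h (- m) = - sin_coef h m.
Proof.
move=> mh hM; rewrite /sin_coef.
rewrite (@eq_Rintegral _ _ _ mu _ (fun x => -1 * (h x * sinm m x))); last first.
  by move=> x _; rewrite sinmN; ring.
rewrite RintegralZl ?mulN1r//.
apply: (@integrable01_bounded _ _ M) => [|x].
  by apply: measurable_funM => //; exact: measurable_sinm.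
by rewrite normrM (le_trans (ler_piMr _ (sinm_le1 _ _))).
Qed.

Lemma normc_ge_Re (z : R[i]) : `|complex.Re z| <= normc z.
Proof. by case: z => p q /=; rewrite -sqrtr_sqr ler_wsqrtr// lerDl sqr_ge0. Qed.

Lemma normc_ge_Im (z : R[i]) : `|complex.Im z| <= normc z.
Proof. by case: z => p q /=; rewrite -sqrtr_sqr ler_wsqrtr// lerDr sqr_ge0. Qed.

Lemma normc_le_ReIm (z : R[i]) : normc z <= `|complex.Re z| + `|complex.Im z|.
Proof.
case: z => p q /=; rewrite -[leRHS]ger0_norm ?addr_ge0// -sqrtr_sqr ler_wsqrtr//.
rewrite sqrrD !real_normK ?num_real// lerD2r lerDl.
by rewrite mulrn_wge0// mulr_ge0.
Qed.

Lemma normc_ge0 (z : R[i]) : 0 <= normc z.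
Proof. exact: le_trans (normr_ge0 _) (normc_ge_Re z). Qed.

(* An essentially bounded function may be replaced by its truncation without
   changing the integrals. *)
Lemma Linfty_circle_fourier f : Linfty_circle f ->
  exists h1, exists h2, exists2 M, 0 <= M &
  [/\ measurable_fun [set: R] h1, measurable_fun [set: R] h2,
      (forall x, `|h1 x| <= M), (forall x, `|h2 x| <= M) &
   forall m, fourier_coef f m =
     ((cos_coef h1 m + sin_coef h2 m) +i* (cos_coef h2 m - sin_coef h1 m))%C].
Proof.
move=> [_ mRe mIm essf].
have aeS (p q : R -> Prop) : (forall x, p x -> q x) ->
    (\forall x \ae mu, p x) -> \forall x \ae mu, q x.
  by apply: (@filterS _ _ (ae_filter_ringOfSetsType mu)).
(* The essential supremum is not known to be non-negative here, so the bound is cut off at 0; the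
   value [-oo] is also allowed. *)
have [M M0 fM] : exists2 M, 0 <= M & \forall x \ae mu, normc (f x) <= M.
  move: essf (ess_sup_ge mu (fun x => (normc (f x))%:E)).
  case: (ess_sup _ _) => [r _ h|//|_ h].
    exists (Num.max 0 r); first by rewrite le_max lexx.
    by apply: aeS h => x; rewrite lee_fin le_max => ->; rewrite orbT.
  by exists 0 => //; apply: aeS h => x; rewrite leeNy_eq.
(* Clamps [v] to [[- M, M]]; the inner expression is the minimum of [v] and [M]. *)
pose trunc (v : R) := Num.max (- M) (- Num.max (- v) (- M)).
have truncM v : `|trunc v| <= M.
  have h : - Num.max (- v) (- M) <= M by rewrite lerNl le_max lexx orbT.
  rewrite ler_norml /trunc le_max lexx/= ge_max h andbT.
  by rewrite (le_trans _ M0)// oppr_le0.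
have truncE v : `|v| <= M -> trunc v = v.
  rewrite ler_norml => /andP[v1 v2]; rewrite /trunc.
  by rewrite [Num.max (- v) _]max_l ?lerN2// opprK max_r.
have mtrunc h : measurable_fun [set: R] h -> measurable_fun [set: R] (trunc \o h).
  move=> mh; apply: (@measurable_maxr _ _ _ _ (cst (- M))) => //.
  by apply: measurable_funN; apply: (@measurable_maxr _ _ _ _ _ (cst (- M))) => //;
    exact: measurable_funN.
exists (fun x => trunc (complex.Re (f x))), (fun x => trunc (complex.Im (f x))), M => //.
have mh1 := mtrunc _ mRe; have mh2 := mtrunc _ mIm.
split => // m.
set h1 := fun x => trunc (complex.Re (f x)); set h2 := fun x => trunc (complex.Im (f x)).
have int_cos h : measurable_fun [set: R] h -> (forall x, `|h x| <= M) ->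
    mu.-integrable `[0, 1] (EFin \o (fun x => h x * cosm m x)).
  move=> mh hM; apply: (@integrable01_bounded _ _ M) => [|x].
    by apply: measurable_funM => //; exact: measurable_cosm.
  by rewrite normrM (le_trans (ler_piMr _ (cosm_le1 _ _))).
have int_sin h : measurable_fun [set: R] h -> (forall x, `|h x| <= M) ->
    mu.-integrable `[0, 1] (EFin \o (fun x => h x * sinm m x)).
  move=> mh hM; apply: (@integrable01_bounded _ _ M) => [|x].
    by apply: measurable_funM => //; exact: measurable_sinm.
  by rewrite normrM (le_trans (ler_piMr _ (sinm_le1 _ _))).
have cisE x : cis2pi (- (m%:~R * x)) = (cosm m x +i* - sinm m x)%C.
  by rewrite /cis2pi /cosm /sinm mulrN cosN sinN.
have ReE x : complex.Re (f x * cis2pi (- (m%:~R * x))) =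
    complex.Re (f x) * cosm m x + complex.Im (f x) * sinm m x.
  by rewrite cisE; case: (f x) => p q /=; ring.
have ImE x : complex.Im (f x * cis2pi (- (m%:~R * x))) =
    complex.Im (f x) * cosm m x - complex.Re (f x) * sinm m x.
  by rewrite cisE; case: (f x) => p q /=; ring.
have mm (g1 g2 : R -> R) : measurable_fun [set: R] g1 -> measurable_fun [set: R] g2 ->
    measurable_fun (`[0, 1]%classic : set (measurableTypeR R))
      (EFin \o (fun x => g1 x * cosm m x + g2 x * sinm m x)).
  move=> mg1 mg2; apply/measurable_EFinP/measurable_funTS.
  by apply: measurable_funD; apply: measurable_funM => //;
    [exact: measurable_cosm|exact: measurable_sinm].
have Rint_ae (g1 g2 g3 g4 : R -> R) :
    measurable_fun [set: R] g1 -> measurable_fun [set: R] g2 ->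
    measurable_fun [set: R] g3 -> measurable_fun [set: R] g4 ->
    (\forall x \ae mu, g1 x = g3 x /\ g2 x = g4 x) ->
    \int[mu]_(x in `[0, 1]) (g1 x * cosm m x + g2 x * sinm m x) =
    \int[mu]_(x in `[0, 1]) (g3 x * cosm m x + g4 x * sinm m x).
  move=> mg1 mg2 mg3 mg4 gae; congr fine; apply: ae_eq_integral;
    [exact: measurable_itv|exact: mm|exact: mm|].
  by apply: aeS gae => x [-> ->].
have ae12 : \forall x \ae mu, complex.Re (f x) = h1 x /\ complex.Im (f x) = h2 x.
  apply: aeS fM => x xM; split.
    by rewrite /h1 truncE// (le_trans (normc_ge_Re _)).
  by rewrite /h2 truncE// (le_trans (normc_ge_Im _)).
rewrite /fourier_coef /Cintegral; have h1M x : `|h1 x| <= M by exact: truncM.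
have h2M x : `|h2 x| <= M by exact: truncM.
congr (_ +i* _)%C.
  under eq_Rintegral do rewrite ReE.
  rewrite (Rint_ae _ _ h1 h2)//.
  by rewrite RintegralD; [|exact: measurable_itv|exact: (int_cos h1)|exact: (int_sin h2)].
under eq_Rintegral do rewrite ImE -mulNr.
rewrite (Rint_ae _ (fun x => - complex.Re (f x)) h2 (fun x => - h1 x))//; last 3 first.
- exact: measurable_funN.
- exact: measurable_funN.
- by apply: aeS ae12 => x [-> ->].
under eq_Rintegral do rewrite mulNr.
by rewrite RintegralB; [|exact: measurable_itv|exact: (int_cos h2)|exact: (int_sin h1)].
Qed.

End fourier_coefficients.

Lemma ler_sum_uniq_int (R : realType) (g : int -> R) (s : seq int) (n : nat) :
  uniq s -> (forall k, 0 <= g k) -> (forall k, k < 0 -> g k = 0) ->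
  (forall k, k \in s -> (`|k| < n)%N) ->
  \sum_(k <- s) g k <= \sum_(j < n) g j%:Z.
Proof.
move=> us g0 gneg sn.
have E k : k \in s -> g k = \sum_(j < n) (if k == j%:Z then g j%:Z else 0).
  move=> ks; have [k0|k0] := ltP k 0.
    rewrite gneg// big1// => j _; case: eqP => // kj.
    by rewrite kj in k0.
  rewrite (bigD1 (Ordinal (sn _ ks)))//= gez0_abs// eqxx big1 ?addr0// => j jk.
  by case: eqP => // kj; move: jk; rewrite -val_eqE/= kj absz_nat eqxx.
rewrite big_seq (eq_bigr _ E) -big_seq exchange_big/=; apply: ler_sum => j _.
have [js|js] := boolP (j%:Z \in s).
  by rewrite (bigD1_seq j%:Z)//= eqxx big1 ?addr0// => k /negPf ->.
rewrite big_seq big1// => k ks; case: eqP => // kj; by rewrite -kj ks in js.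
Qed.

Section conclusions.
Variables (R : realType) (a B : R) (y : nat -> R).
Hypothesis a_gt0 : 0 < a.
Hypothesis a_le : 4 * a <= 1.
Hypothesis y01 : forall k, y k = 0 \/ y k = 1.
Hypothesis rB : forall N, riesz (fun k _ => a * y k) N 0 <= B.
Hypothesis y0 : y 0%N = 0.

Lemma cos_coef_sum_le (h : R -> R) M n : measurable_fun [set: R] h ->
  (forall x, `|h x| <= M) -> (forall k, y k = 0 -> cos_coef h k%:Z = 0) ->
  \sum_(j < n) `|cos_coef h j%:Z| <= 8 * B ^+ 2 / a ^+ 2 * M.
Proof.
move=> mh hM hy; have M0 : 0 <= M by exact: le_trans (normr_ge0 _) (hM 0).
apply: (fejer_bound_sum a_gt0 a_le y01 rB (A := fun j => cos_coef h j%:Z)) => //.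
  exact: hy.
move=> x; rewrite (eq_bigr (fun k : 'I_n.*2 => \sum_(l < n.*2)
  cos_coef h (k%:Z - l%:Z) * cosm (k%:Z - l%:Z) x)).
  exact: fejer_mean_le.
move=> k _; apply: eq_bigr => l _; congr (_ * _).
have [kl|kl] := leP 0 (k%:Z - l%:Z); first by rewrite gez0_abs.
by rewrite lez0_abs ?cos_coefN// ltW.
Qed.

(** As the spectrum is positive, vanishing at [- k] expresses the sine coefficients of the real and
    imaginary parts through their cosine coefficients. The coefficient at [k] is then twice the pair
    of cosine coefficients, and each of these two families is summable by the real bound. *)
Lemma sidon_of_riesz_bound : sidon R [set n%:Z | n in [set k | y k = 1]].
Proof.
move=> f /Linfty_circle_fourier[h1 [h2 [M M0 [mh1 mh2 h1M h2M fE]]]] fsupp.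
have notE k : y k = 0 -> ~ [set n%:Z | n in [set k | y k = 1]] k%:Z.
  by move=> yk [l /= yl [lk]]; move: yl; rewrite lk yk => /eqP; rewrite eq_sym oner_eq0.
have notEN (k : nat) : ~ [set n%:Z | n in [set k | y k = 1]] (- k%:Z).
  move=> [l /= yl lk]; have l0 : l = 0%N by lia.
  by move: yl; rewrite l0 y0 => /eqP; rewrite eq_sym oner_eq0.
have neg (k : nat) : cos_coef h1 k%:Z = sin_coef h2 k%:Z /\
    cos_coef h2 k%:Z = - sin_coef h1 k%:Z.
  have := fsupp _ (@notEN k); rewrite fE !cos_coefN.
  rewrite (sin_coefN _ mh1 h1M) (sin_coefN _ mh2 h2M) => -[h h'].
  by split; apply/eqP; rewrite -subr_eq0 ?h ?h'.
have pos (k : nat) : fourier_coef f k%:Z =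
    ((2 * cos_coef h1 k%:Z) +i* (2 * cos_coef h2 k%:Z))%C.
  have [e1 e2] := neg k; rewrite fE; congr (_ +i* _)%C.
    by rewrite -e1; ring.
  by rewrite -e2; ring.
have cE k : y k = 0 -> cos_coef h1 k%:Z = 0 /\ cos_coef h2 k%:Z = 0.
  move=> /notE /fsupp; rewrite pos => -[/eqP + /eqP].
  by rewrite !mulf_eq0/= !pnatr_eq0/= => /eqP -> /eqP ->.
pose C := 8 * B ^+ 2 / a ^+ 2 * M.
rewrite /summable (@le_lt_trans _ _ (2 * (C + C))%:E) ?ltry//.
apply: ub_ereal_sup => _ [X [Xfin _] <-].
rewrite fsbig_finite//=.
rewrite (eq_bigr (fun k => (normc (fourier_coef f k))%:E)); last first.
  by move=> k _; rewrite ger0_norm ?normc_ge0.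
set s := fset_set X; pose n := (\max_(k <- s) `|k|%N).+1.
rewrite sumEFin lee_fin.
apply: (@le_trans _ _ (\sum_(j < n) normc (fourier_coef f j%:Z))).
  apply: (@ler_sum_uniq_int _ (fun k => normc (fourier_coef f k))) => //.
  - exact: fset_uniq.
  - by move=> k; exact: normc_ge0.
  - move=> k k0; rewrite fsupp ?normc0// => -[l _ lk].
    by rewrite -lk in k0.
  - by move=> k ks; rewrite ltnS; exact: (@leq_bigmax_seq int (enum_fset s) xpredT absz k ks isT).
apply: (@le_trans _ _ (\sum_(j < n) 2 * (`|cos_coef h1 j%:Z| + `|cos_coef h2 j%:Z|))).
  apply: ler_sum => j _; rewrite pos (le_trans (normc_le_ReIm _))//=.
  by rewrite !normrM (@ger0_norm _ 2)// mulrDr.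
rewrite -mulr_sumr ler_pM2l// big_split/= lerD//.
  by apply: cos_coef_sum_le => // k /cE[].
by apply: cos_coef_sum_le => // k /cE[].
Qed.

(** At the point given by [negative_averages], the real parts of the averages are eventually at most
    [- a / (4 * B)], so the averages do not tend to 0. *)
Lemma not_hartman_of_riesz_bound : ~ hartman_distributed R [set k | y k = 1].
Proof.
move=> [n [n_incr n_range] avg0].
have [K0 K00 [x xneg]] := negative_averages a_gt0 a_le y01 rB n_incr n_range y0.
have xint := negative_average_not_int a_gt0 rB xneg.
have t0 : 0 < a / B / 4.
  by rewrite !divr_gt0// (lt_le_trans _ (riesz_bound_ge1 rB)).
have := avg0 x xint; move=> /cvgr_lt /(_ _ t0)[K _ hK].
pose N := maxn K K0.
have : normc (N%:R^-1 * \sum_(k < N) cis2pi ((n k)%:R * x)) < a / B / 4.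
  by apply: hK; rewrite /= leq_maxl.
apply/negP; rewrite -leNgt (le_trans _ (normc_ge_Re _))//.
have N0 : (0 < N)%N by rewrite (leq_trans K00)// leq_maxr.
have -> : complex.Re (N%:R^-1 * \sum_(k < N) cis2pi ((n k)%:R * x)) =
    N%:R^-1 * \sum_(k < N) cosm (n k)%:Z x.
  have -> : (N%:R^-1 : R[i]) = (N%:R^-1)%:C%C by rewrite fmorphV rmorph_nat.
  have -> (r : R) (z : R[i]) : complex.Re (r%:C%C * z) = r * complex.Re z.
    by case: z => p q /=; rewrite mul0r subr0.
  congr (_ * _); rewrite (big_morph (@complex.Re R) (id1 := 0) (op1 := +%R))//.
  by case=> ? ? [].
rewrite ler_normr; apply/orP; right.
rewrite -mulrN ler_pdivlMl ?ltr0n// lerNr.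
apply: (le_trans (xneg N (leq_maxr _ _))).
by rewrite mulNr mulrC.
Qed.

End conclusions.

Theorem theorem5p12 (R : realType) (d : measure_display) (T : measurableType d)
    (P : probability T R) (delta : nat -> R) (xi : nat -> {RV P >-> R})
    (delta_noninc : forall k l, (0 < k)%N -> (k <= l)%N -> delta l <= delta k)
    (delta_ge0 : forall k, (0 < k)%N -> 0 <= delta k)
    (delta_lt1 : forall k, (0 < k)%N -> delta k < 1)
    (delta_div : (\sum_(1 <= k <oo) (delta k)%:E = +oo)%E)
    (xi_01 : forall k, (0 < k)%N -> forall w, xi k w = 0 \/ xi k w = 1)
    (xi_mean : forall k, (0 < k)%N -> 'E_P[xi k]%E = (delta k)%:E)
    (xi_indep : independent_RVs P [set k | (0 < k)%N] xi)
    (m_log : (fun N => \sum_(1 <= k < N.+1) delta k) =O_\oo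
             (fun N => ln (N%:R : R))) :
  {ae P, forall w, sidon R [set n%:Z | n in random_set xi w]} /\
  {ae P, forall w, ~ hartman_distributed R (random_set xi w)}.
Proof.
(* Extends [delta] by 0 to index 0, so that non-negativity holds at every index. *)
pose D k := if (0 < k)%N then delta k else 0.
have D0 k : 0 <= D k by rewrite /D; case: ifP => // /delta_ge0.
have Dni k l : (0 < k)%N -> (k <= l)%N -> D l <= D k.
  by move=> k0 kl; rewrite /D k0 (leq_trans k0 kl) delta_noninc.
have [C [N0 [C1 N00 mC]]] : exists C : R, exists N0, [/\ 1 <= C, (0 < N0)%N &
    forall N, (N0 <= N)%N -> \sum_(1 <= k < N.+1) D k <= C * ln N%:R].
  move/eqO_exP : m_log => [c c0 [N0 _ hN0]].
  (* [C >= 1] will give [4 * a <= 1], and a positive threshold makes the logarithm non-negative. *)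
  exists (Num.max 1 c), N0.+1; split => //; first by rewrite le_max lexx.
  move=> N N0N; have ln0 : 0 <= ln N%:R :> R.
    by rewrite ln_ge0// ler1n (leq_trans _ N0N).
  have -> : \sum_(1 <= k < N.+1) D k = \sum_(1 <= k < N.+1) delta k.
    by apply: eq_big_nat => k /andP[k0 _]; rewrite /D k0.
  apply: (le_trans (ler_norm _)); apply: (le_trans (hN0 N (ltnW N0N))).
  by rewrite (ger0_norm ln0) ler_wpM2r// le_max lexx orbT.
have C0 : 0 < C by exact: lt_le_trans C1.
(* Makes [4 * a] equal to the factor [(4 * C)^-1] in the products bounded by
   [sum_noninc_prod_bounded]. *)
pose a := (16 * C)^-1.
have a0 : 0 < a by rewrite invr_gt0 mulr_gt0.
have a4 : 4 * a = (4 * C)^-1 by rewrite /a; field; rewrite gt_eqF.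
have a4_le1 : 4 * a <= 1.
  by rewrite a4 invf_le1 ?mulr_gt0//; lra.
have [S hS] := sum_noninc_prod_bounded C0 N00 Dni D0 mC.
have rS N : riesz (fun k _ => a * D k) N 0 <= 1 + 16 * a ^+ 2 * S.
  apply: (le_trans (riesz_noninc_le N (ltW a0) Dni D0)).
  rewrite lerD2l a4; apply: ler_wpM2l => //.
  by apply: mulr_ge0 => //; exact: sqr_ge0.
have xi_meanD k : (0 < k)%N -> 'E_P[xi k]%E = (D k)%:E.
  by move=> k0; rewrite /D k0 xi_mean.
have ae_bound := ae_riesz_bounded xi_01 xi_meanD xi_indep (ltW a0) rS.
have setE w : random_set xi w =
    [set k | (if (0 < k)%N then xi k w else 0) = 1].
  apply/seteqP; split => k /=; first by case=> ->.
  by case: ifP => [k0 xi1|_ /eqP]; [split|rewrite eq_sym oner_eq0].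
have y01 w k : (if (0 < k)%N then xi k w else 0) = 0 \/
    (if (0 < k)%N then xi k w else 0) = 1.
  by case: ifP => [k0|_]; [exact: xi_01|left].
split; apply: filterS ae_bound => w [B wB]; rewrite setE.
- exact: (sidon_of_riesz_bound a0 a4_le1 (y01 w) wB).
- exact: (not_hartman_of_riesz_bound a0 a4_le1 (y01 w) wB).
Qed.
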